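(* Let $\mathcal{X},\mathcal{Y}$ be Polish spaces, and consider the controlled partially observed Markov process with control action space $\mathcal{U}$, controlled transition kernel $T(dx'|x,u)$ from $\mathcal{X}\times\mathcal{U}$ to $\mathcal{X}$, and measurement kernel $Q:\mathcal{X}\to\mathcal{P}(\mathcal{Y})$. Assume that $Q$ is dominated, and let $\tilde\delta(T)=\inf_{u\in\mathcal{U}}\delta(T(\cdot|\cdot,u))$. If $$\alpha=(1-\tilde\delta(T))(2-\delta(Q))<1,$$ then the filter is exponentially stable with coefficient $\alpha$ for any control policy; that is, under any control policy, for all $\mu,\nu\in\mathcal{P}(\mathcal{X})$ with $\mu\ll\nu$ and all $n\in\{0,1,2,\dots\}$, $$E^{\mu}\big[\|\pi_{n+1}^{\mu}-\pi_{n+1}^{\nu}\|_{TV}\big]\le\alpha\,E^{\mu}\big[\|\pi_{n}^{\mu}-\pi_{n}^{\nu}\|_{TV}\big].$$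
   Context: $\mathcal{P}(S)$ denotes the set of Borel probability measures on a Polish space $S$. Controlled process: $X_0\sim\mu$; at each time $n$ the observer sees $Y_n\sim Q(dy|X_n)$ (given $X_n$, independent of the rest of the past), then a control action $U_n\in\mathcal{U}$ is applied, and $X_{n+1}\sim T(dx'|X_n,U_n)$ (conditionally on the entire past). A control policy selects $U_n$ (measurably, possibly with independent randomization) on the basis of the observer's information $(Y_{[0,n]},U_{[0,n-1]})$, where $Y_{[0,n]}=(Y_0,\dots,Y_n)$ and $U_{[0,n-1]}=(U_0,\dots,U_{n-1})$; $\mathcal{U}$ is a (standard Borel) measurable space. For a fixed policy, $P^\mu$ and $E^\mu$ denote the resulting law and expectation when $X_0\sim\mu$. Dominated: $Q$ is dominated if there is $\lambda\in\mathcal{P}(\mathcal{Y})$ with $Q(dy|x)\ll\lambda$ for every $x\in\mathcal{X}$; $g(x,y)=\frac{dQ(\cdot|x)}{d\lambda}(y)$ denotes the (jointly measurable) likelihood function. Bayesian update operator: $\psi(\pi,y)(dx)=\frac{g(x,y)\pi(dx)}{\int_{\mathcal{X}}g(x',y)\pi(dx')}$ if the denominator is positive, and $\psi(\pi,y)=0$ (zero measure) otherwise. Filter: $\pi_n^\mu(\cdot)=P^\mu(X_n\in\cdot\mid Y_{[0,n]},U_{[0,n-1]})$. It is computed recursively by $\pi_0^\mu=\psi(\mu,Y_0)$ and $$\pi_{n+1}^\mu(dx)=\frac{g(x,Y_{n+1})\int_{\mathcal{X}}T(dx|x',U_n)\pi_n^\mu(dx')}{\int_{\mathcal{X}}g(x,Y_{n+1})\int_{\mathcal{X}}T(dx|x',U_n)\pi_n^\mu(dx')},$$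 i.e. $\pi_{n+1}^\mu=\psi\big(\int_{\mathcal{X}}T(\cdot|x',U_n)\pi_n^\mu(dx'),Y_{n+1}\big)$. The incorrectly initialized filter $\pi_n^\nu$ is computed by the same recursion started from $\pi_0^\nu=\psi(\nu,Y_0)$, using the same measurements and control actions; in $E^\mu$ these are generated under $P^\mu$. Total variation norm: $\|P-P'\|_{TV}=\sup_{\|f\|_\infty\le 1}\left|\int f\,dP-\int f\,dP'\right|$, the supremum being over measurable real functions $f$ with $\|f\|_\infty\le1$. Dobrushin coefficient: for a probability kernel $K:S_1\to\mathcal{P}(S_2)$, $\delta(K)=\inf\sum_{i=1}^{m}\min(K(x,A_i),K(x',A_i))$, where the infimum is over all $x,x'\in S_1$ and all finite measurable partitions $\{A_i\}_{i=1}^m$ of $S_2$. For each fixed $u$, $T(\cdot|\cdot,u)$ is the kernel $x\mapsto T(dx'|x,u)$ from $\mathcal{X}$ to $\mathcal{P}(\mathcal{X})$. *)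

(* Defs.v *)
From HB Require Import structures.
From mathcomp Require Import all_boot all_order all_algebra.
From mathcomp Require Import all_classical all_reals all_analysis.

Set Implicit Arguments.
Unset Strict Implicit.
Unset Printing Implicit Defensive.
Import Order.TTheory GRing.Theory Num.Theory.
Import numFieldTopology.Exports numFieldNormedType.Exports.

Local Open Scope classical_set_scope.
Local Open Scope ring_scope.
Local Open Scope ereal_scope.

Definition separable_space (T : topologicalType) : Prop :=
  exists2 D : set T, countable D & dense D.

Definition complete_metric (R : realType) (M : metricType R) : Prop :=
  forall F : set_system M, ProperFilter F -> cauchy F -> exists l : M, F --> l.

Definition homeomorphic (S T : topologicalType) : Prop :=
  exists (f : S -> T) (g : T -> S),
    [/\ cancel f g, cancel g f, continuous f & continuous g].

Definition polish (R : realType) (T : topologicalType) : Prop :=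
  separable_space T /\
  exists M : metricType R, complete_metric M /\ homeomorphic T M.

Notation borel T := (g_sigma_algebraType (@open T)).

Definition standard_borel (R : realType) d (U : measurableType d) : Prop :=
  exists2 S : ptopologicalType, polish R S &
    exists (f : U -> borel S) (g : borel S -> U),
      [/\ cancel f g, cancel g f,
          measurable_fun [set: U] f & measurable_fun [set: borel S] g].

Section kernels_and_norms.
Context (R : realType) d (T : measurableType d).

Definition tv_dist (P P' : set T -> \bar R) : \bar R :=
  ereal_sup [set `| \int[P]_x (f x)%:E - \int[P']_x (f x)%:E | |
    f in [set f : T -> R | measurable_fun [set: T] f /\
                           forall x, (`|f x| <= 1)%R]].

(* Empty cells are allowed in a partition; they contribute 0 to the sum. *)
Definition measurable_partition (m : nat) (A : 'I_m -> set T) : Prop :=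
  [/\ forall i, measurable (A i), trivIset [set: 'I_m] A &
      \bigcup_i A i = [set: T]].

Definition dobrushin (S : Type) (K : S -> {measure set T -> \bar R}) : \bar R :=
  ereal_inf [set r | exists (x x' : S) (m : nat) (A : 'I_m -> set T),
    measurable_partition A /\
    r = \sum_(i < m) Order.min (K x (A i)) (K x' (A i))].

End kernels_and_norms.

Section likelihood.
Context (R : realType) dX dY (X : measurableType dX) (Y : measurableType dY).

Definition kernel_dominated (Q : X -> {measure set Y -> \bar R})
    (lambda : probability Y R) : Prop :=
  forall x, Q x `<< lambda.

(* [g] is a jointly measurable, [0, oo)-valued version of dQ(.|x)/dlambda. *)
Definition is_likelihood (Q : X -> {measure set Y -> \bar R})
    (lambda : probability Y R) (g : X * Y -> R) : Prop :=
  [/\ measurable_fun [set: X * Y] g, forall xy, (0 <= g xy)%R &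
      forall x A, measurable A -> Q x A = \int[lambda]_(y in A) (g (x, y))%:E].

End likelihood.

Section filter_recursion.
Context (R : realType) dX dY dU (X : measurableType dX)
  (Y : measurableType dY) (U : measurableType dU).
Variables (g : X * Y -> R) (T : R.-pker (X * U) ~> X).

(* The evidence can be +oo only for an exceptional set of observations; then
   the quotient is 0 by the convention r / +oo = 0. *)
Definition bayes_update (rho : set X -> \bar R) (y : Y) (A : set X) : \bar R :=
  let evidence := \int[rho]_x (g (x, y))%:E in
  if 0 < evidence then (\int[rho]_(x in A) (g (x, y))%:E) / evidence else 0.

Definition predict (rho : set X -> \bar R) (u : U) (A : set X) : \bar R :=
  \int[rho]_x T (x, u) A.

Fixpoint filter_rec (nu : set X -> \bar R) (y : nat -> Y) (u : nat -> U)
    (n : nat) : set X -> \bar R :=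
  if n is n'.+1 then
    bayes_update (predict (filter_rec nu y u n') (u n')) (y n'.+1)
  else bayes_update nu (y 0%N).

End filter_recursion.

Section controlled_process.
Context (R : realType) dO (Omega : measurableType dO) (P : probability Omega R).

(* [k] is a conditional law of [Z] given [W]. *)
Definition cond_law dS dS' (S : measurableType dS) (S' : measurableType dS')
    (W : Omega -> S) (Z : Omega -> S') (k : S -> {measure set S' -> \bar R}) :
    Prop :=
  forall A B, measurable A -> measurable B ->
    P (W @^-1` A `&` Z @^-1` B) = \int[P]_(w in W @^-1` A) k (W w) B.

(* The segment (Z_0, ..., Z_{n-1}). *)
Definition segment (S : Type) (Z : nat -> Omega -> S) (n : nat) (w : Omega) :
    n.-tuple S :=
  [tuple Z i w | i < n].

Context dX dY dU (X : measurableType dX) (Y : measurableType dY)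
  (U : measurableType dU).

(* A randomized policy: the law of U_n given (Y_[0,n], U_[0,n-1]). *)
Definition policy : Type :=
  forall n : nat, R.-pker (n.+1.-tuple Y * n.-tuple U)%type ~> U.

Section process.
Variables (X_ : nat -> {RV P >-> X}) (Y_ : nat -> {RV P >-> Y})
  (U_ : nat -> {RV P >-> U}).

Definition info (n : nat) (w : Omega) : n.+1.-tuple Y * n.-tuple U :=
  (segment Y_ n.+1 w, segment U_ n w).

(* (X_[0,i-1], Y_[0,j-1], U_[0,k-1]) *)
Definition history (i j k : nat) (w : Omega) :
    i.-tuple X * j.-tuple Y * k.-tuple U :=
  (segment X_ i w, segment Y_ j w, segment U_ k w).

(* The variables are drawn in the order X_0, Y_0, U_0, X_1, Y_1, U_1, ...;
   each conditional law is given the entire past. *)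
Definition controlled_process (mu : probability X R)
    (T : R.-pker (X * U) ~> X) (Q : R.-pker X ~> Y) (gamma : policy) : Prop :=
  [/\ forall A, measurable A -> distribution P (X_ 0%N) A = mu A,
      forall n, cond_law (history n.+1 n n) (Y_ n)
        (fun h => Q (tnth h.1.1 ord_max)),
      forall n, cond_law (history n.+1 n.+1 n) (U_ n)
        (fun h => gamma n (h.1.2, h.2)) &
      forall n, cond_law (history n.+1 n.+1 n.+1) (X_ n.+1)
        (fun h => T (tnth h.1.1 ord_max, tnth h.2 ord_max))].

(* [pi_ n] is a regular conditional law of X_n given (Y_[0,n], U_[0,n-1]). *)
Definition is_filter
    (pi_ : forall n : nat, R.-pker (n.+1.-tuple Y * n.-tuple U)%type ~> X) :
    Prop :=
  forall n, cond_law (info n) (X_ n) (pi_ n).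

End process.
End controlled_process.

(* Main.v *)
Require Import Defs.
From HB Require Import structures.
From mathcomp Require Import all_boot all_order all_algebra.
From mathcomp Require Import all_classical all_reals all_analysis.
From mathcomp Require Import measurable_realfun.
From mathcomp Require Import ring lra.
Set Implicit Arguments.
Unset Strict Implicit.
Unset Printing Implicit Defensive.
Import Order.TTheory GRing.Theory Num.Theory.
Import numFieldTopology.Exports numFieldNormedType.Exports.
Local Open Scope classical_set_scope.
Local Open Scope ring_scope.
Local Open Scope ereal_scope.

(** The Bayes filter alternates two maps on probability measures, and each has a
Lipschitz constant for the total variation norm. Prediction by [T (., u)] contracts by
[1 - dobrushin (T (., u))]. The Bayes update need not contract, but it expands by at
most [2 - dobrushin Q] on average over the observation. The product of the two
constants is the coefficient of the theorem.

Both estimates become elementary once the total variation of [m1] and [m2] is read off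
a Hahn set [A], where [m1] dominates, its complement being where [m2] does: for
probabilities it is [2 (m1 A - m2 A)] ([tv_distE]). For prediction, the values
[K x B] oscillate by at most [1 - dobrushin K], since [B] and its complement form one
of the partitions in the Dobrushin infimum ([integral_kernel_le], [predict_tv]). For
the update, let [N1], [N2] be the evidences of the priors [s1], [s2] at the
observation [y]. Then [N1] times half the distance of the posteriors is at most
[G1 A - G2 A + (N2 - N1)^+], where [Gi A] is the integral over [A] of [g (., y)]
against [si] ([bayes_update_tv_pointwise]). Integrated against [lambda], the first
difference becomes [s1 A - s2 A], and the positive part becomes the distance of the two
laws of the observation, which is contracted by [1 - dobrushin Q] ([bayes_update_tv]).

The passage from measures to the process rests on three facts. Given the information
and the control, the next observation has density [N1] with respect to [lambda]; this
is exactly the weight in the update estimate ([integral_observation]). The true filter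
is a regular conditional law, and it satisfies the Bayes recursion almost surely
because conditional laws are unique on a space whose sigma-algebra is countably
generated ([cond_law_unique], [ae_posterior]); the Borel sigma-algebra of a Polish
space is ([polish_generating_algebra]). The same countable algebra makes the total
variation a countable supremum, hence a measurable function of the parameters of the
two measures ([measurable_tv_dist]), so that it can be disintegrated. Finally, [mu] is
dominated by [nu], and this domination propagates to the two filters: almost surely
the wrong filter charges whatever the true one does ([update_step_dominates]), so its
evidence does not vanish and it stays a probability. Without this the wrong filter
could become the null measure, on which prediction does not contract. *)

(** * Countably generated sigma-algebras *)

(** Countably many generators closed under complement and union: every measurable
set is then approximated by the [C n] for any finite measure, which bare generators
would not give. *)
Definition generating_algebra d (T : measurableType d) (C : nat -> set T) :=
  [/\ forall n, measurable (C n), forall n, exists m, C m = ~` C n,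
      forall n m, exists k, C k = C n `|` C m &
      measurable `<=` <<s range C >>].

Lemma countable_setU (T : Type) (A B : set T) :
  countable A -> countable B -> countable (A `|` B).
Proof.
move=> cA cB; rewrite (_ : _ `|` _ = \bigcup_(b in [set: bool]) if b then A else B).
  by apply: bigcup_countable => // -[].
apply/seteqP; split=> [x [Ax|Bx]|x [[] _]]; [by exists true|by exists false|..].
  by left.
by right.
Qed.

(** The algebra generated by a countable family is exhausted by countably many rounds of
complements and pairwise unions. The last clause is the induction principle of this
construction, restricted to sigma-algebras. *)
Lemma countable_algebra (T : Type) (B : set (set T)) : countable B ->
  exists C : nat -> set T,
    [/\ B `<=` range C, forall n, exists m, C m = ~` C n,
        forall n m, exists k, C k = C n `|` C m &
        forall D : set (set T), B `<=` D -> sigma_algebra setT D ->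
          range C `<=` D].
Proof.
move=> cB.
pose next (E : set (set T)) := setC @` E `|`
  (fun p : set T * set T => p.1 `|` p.2) @` (E `*` E).
pose G := fix G n := if n is n'.+1 then next (G n') else B `|` [set set0].
(* [next E] contains [E] because a union with itself is allowed. *)
have Gle n : G n `<=` G n.+1.
  by move=> A GA; right; exists (A, A) => //=; rewrite setUid.
have Gmon n m : (n <= m)%N -> G n `<=` G m.
  elim: m => [|m IH]; first by rewrite leqn0 => /eqP ->.
  rewrite leq_eqVlt ltnS => /predU1P[->//|/IH nm].
  exact: subset_trans nm (@Gle m).
have cG n : countable (G n).
  elim: n => [|n IH] /=; apply: countable_setU => //.
  - by apply: sub_countable IH; exact: card_image_le.
  - apply: (@sub_countable _ _ _ (G n `*` G n)); first exact: card_image_le.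
    exact: countableX.
pose Ginf := \bigcup_n G n.
have cGinf : countable Ginf by exact: bigcup_countable.
have /pfcard_geP[G0|[f]] := cGinf.
  have : Ginf set0 by exists 0%N => //; right.
  by rewrite G0.
have fG n : exists m, G m (f n).
  have [m _ Gm] : Ginf (f n) by exact: funS.
  by exists m.
have Gf A m : G m A -> exists n, f n = A.
  move=> GA; have /(@surj _ _ _ _ f)[n _ <-] : Ginf A by exists m.
  by exists n.
exists f; split.
- by move=> A BA; have [|n] := Gf A 0%N; [left|exists n].
- move=> n; have [m Gm] := fG n; apply: (Gf _ m.+1) => /=.
  by left; exists (f n).
- move=> n m; have [a Ga] := fG n; have [b Gb] := fG m.
  apply: (Gf _ (maxn a b).+1); right; exists (f n, f m) => //; split => /=.
    exact: (Gmon _ _ (leq_maxl _ _)) Ga.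
  exact: (Gmon _ _ (leq_maxr _ _)) Gb.
- move=> D BD [D0 DC DU] _ [n _ <-]; have [m] := fG n.
  have DT : D setT by rewrite -setC0 -setTD; exact: DC.
  elim: m (f n) => [|m IH] A /=; first by move=> [/BD//|->].
  move=> [[E /IH DE <-]|[[E F] /= [/IH DE /IH DF] <-]].
    by rewrite -setTD; exact: DC.
  rewrite (_ : _ `|` _ = \bigcup_i (if i is 0%N then E else F)).
    by apply: DU => -[|i].
  apply/seteqP; split=> [x [?|?]|x [[|i] _ ?]]; [by exists 0%N|by exists 1%N|by left|by right].
Qed.

(** Finite measures see a set only up to small symmetric differences, and the sets
approximable by an algebra form a sigma-algebra. *)
Lemma generating_algebra_approx d (T : measurableType d) (R : realType)
    (C : nat -> set T) (m : {finite_measure set T -> \bar R}) :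
  generating_algebra C -> forall A, measurable A -> forall e : R, (0 < e)%R ->
  exists n, m (A `\` C n) + m (C n `\` A) < e%:E.
Proof.
move=> [mC CC CU sC] A mA.
pose D := [set A | measurable A /\ forall e : R, (0 < e)%R ->
  exists n, m (A `\` C n) + m (C n `\` A) < e%:E].
suff [//] : D A by [].
have DC : range C `<=` D.
  move=> _ [n _ <-]; split=> // e e0; exists n.
  by rewrite setDv !measure0 adde0 lte_fin.
have DCc B : D B -> D (~` B).
  move=> [mB aB]; split=> [|e e0]; first exact: measurableC.
  have [n nB] := aB e e0; have [k kn] := CC n; exists k.
  rewrite kn addeC !setDE !setCK setIC -setDE.
  by rewrite (setIC (~` B)) -setDE.
have D0 : D set0.
  split=> // e e0; have [k kn] := CC 0%N; have [l ln] := CU 0%N k.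
  have [j jl] := CC l; exists j.
  by rewrite jl ln kn setUv setCT setDv !measure0 adde0 lte_fin.
suff sD : sigma_algebra setT D by move: A mA => A /sC; apply: smallest_sub.
split => //; first by move=> B /DCc; rewrite setTD.
move=> F DF; split=> [|e e0]; first by apply: bigcupT_measurable => i; case: (DF i).
have mF i : measurable (F i) by case: (DF i).
pose U n := \bigcup_(i < n) F i.
have mU n : measurable (U n) by exact: bigcup_measurable.
(* A countable union is within [e / 2] of a finite one, which is approximated in turn. *)
have DU n : D (U n).
  elim: n => [|n [mUn IH]]; first by rewrite /U II0 bigcup_set0.
  split=> // r r0; have r20 : (0 < r / 2)%R by rewrite divr_gt0.
  have [a ha] := IH _ r20; have [_ /(_ _ r20)[b hb]] := DF n.
  have [k kab] := CU a b; exists k; rewrite kab /U bigcup_mkord big_ord_recr /=.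
  rewrite -bigcup_mkord -/(U n).
  apply: (@le_lt_trans _ _ ((m (U n `\` C a) + m (F n `\` C b)) +
       (m (C a `\` U n) + m (C b `\` F n)))).
    apply: leeD.
      apply: (@le_trans _ _ (m ((U n `\` C a) `|` (F n `\` C b)))).
        apply: le_measure; rewrite ?inE.
        - by apply: measurableD; apply: measurableU.
        - by apply: measurableU; apply: measurableD.
        - by move=> x [[?|?] /not_orP[]]; [left|right].
      by apply: measureU2; apply: measurableD.
    apply: (@le_trans _ _ (m ((C a `\` U n) `|` (C b `\` F n)))).
      apply: le_measure; rewrite ?inE.
      - by apply: measurableD; apply: measurableU.
      - by apply: measurableU; apply: measurableD.
      - by move=> x [[?|?] /not_orP[]]; [left|right].
    by apply: measureU2; apply: measurableD.
  by rewrite addeACA [r]splitr EFinD; exact: lteD.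
have cvgm : m (\bigcup_i F i `\` U n) @[n --> \oo] --> m (set0 : set T).
  rewrite (_ : set0 = \bigcap_n (\bigcup_i F i `\` U n)).
    apply: nonincreasing_cvg_mu => //.
    - rewrite -ge0_fin_numE//; apply: fin_num_measure.
      by apply: measurableD => //; exact: bigcupT_measurable.
    - by move=> n; apply: measurableD => //; exact: bigcupT_measurable.
    - by apply: bigcapT_measurable => n; apply: measurableD => //; exact: bigcupT_measurable.
    - move=> n k nk; apply/subsetPset => x [? Ux]; split=> // -[i /= ik Fi].
      by apply: Ux; exists i => //=; exact: leq_trans nk.
  apply/seteqP; split=> // x h; have [[i _ Fi] _] := h 0%N I.
  by have [_] := h i.+1 I; apply; exists i => /=.
have e20 : (0 < e / 2)%R by rewrite divr_gt0.
have [n hn] : exists n, m (\bigcup_i F i `\` U n) < (e / 2)%:E.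
  have /= : \forall n \near \oo, m (\bigcup_i F i `\` U n) < (e / 2)%:E.
    have m0 : m set0 < (e / 2)%:E by rewrite measure0 lte_fin.
    exact: cvgm _ (open_ereal_lt' m0).
  by move=> [n _ nm]; exists n; exact: nm (leqnn n).
have [_ /(_ _ e20)[k hk]] := DU n; exists k.
rewrite [e]splitr EFinD; apply: le_lt_trans (lteD hn hk).
rewrite addeA; apply: leeD.
  apply: (@le_trans _ _ (m ((\bigcup_i F i `\` U n) `|` (U n `\` C k)))).
    apply: le_measure; rewrite ?inE.
    - by apply: measurableD => //; exact: bigcupT_measurable.
    - by apply: measurableU; apply: measurableD => //; exact: bigcupT_measurable.
    - by move=> x [? ?]; have [?|?] := pselect (U n x); [right|left].
  by apply: measureU2; apply: measurableD => //; exact: bigcupT_measurable.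
apply: le_measure; rewrite ?inE.
- by apply: measurableD => //; exact: bigcupT_measurable.
- exact: measurableD.
- by move=> x [? nF]; split=> // -[i _ Fi]; apply: nF; exists i.
Qed.

(** Preimages of balls centred in a countable dense set form a base, so every open set
is a union of members of the countable algebra that they generate. *)
Lemma polish_generating_algebra (R : realType) (T : ptopologicalType) :
  polish R T -> exists C : nat -> set (borel T), generating_algebra C.
Proof.
move=> [[D cD dD] [M [_ [f [g [fK gK cf cg]]]]]].
pose r (n : nat) : R := (n.+1%:R^-1)%R.
pose V (p : T * nat) : set T := f @^-1` (ball (f p.1) (r p.2))°.
have oV p : open (V p) by move: cf => /continuousP; apply; exact: open_interior.
pose B := V @` (D `*` setT).
have cB : countable B.
  by apply: (sub_countable (card_image_le _ _)); exact: countableX.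
have baseB (U : set T) x : open U -> U x -> exists2 W, B W & W x /\ W `<=` U.
  move=> oU Ux.
  have oU' : open (g @^-1` U) by move: cg => /continuousP; exact.
  have /nbhs_ballP[_/posnumP[e] eU] : nbhs (f x) (g @^-1` U).
    by apply: open_nbhs_nbhs; split => //=; rewrite fK.
  have [n ne] : exists n, (r n < e%:num / 2)%R.
    have [//|n] := @ltr_add_invr R 0%R (e%:num / 2).
    by rewrite add0r => ?; exists n.
  have r20 : (0 < r n / 2)%R by rewrite divr_gt0// invr_gt0.
  have [y [/= By Dy]] : (f @^-1` (ball (f x) (r n / 2))°) `&` D !=set0.
    apply: dD; last by move: cf => /continuousP; apply; exact: open_interior.
    by exists x; rewrite /= /interior; exact: nbhsx_ballx.
  have {}By : ball (f x) (r n / 2)%R (f y) by exact: interior_subset By.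
  exists (V (y, n)); first by exists (y, n).
  split.
    rewrite /V /= /interior /=; apply/nbhs_ballP; exists (r n / 2)%R => //= z xz.
    by rewrite [r n]splitr; apply: ball_triangle xz; exact: ball_sym.
  move=> z /interior_subset /= yz; rewrite -(fK z); apply: eU.
  rewrite /= [e%:num%R]splitr; apply: (@ball_triangle _ _ (f y)).
    apply: le_ball By; rewrite (le_trans _ (ltW ne))// ler_pdivrMr// ler_peMr//.
      by rewrite ltW// invr_gt0.
    by rewrite ler1n.
  by apply: le_ball yz; exact: ltW.
have [C [BC CC CU sC]] := countable_algebra cB.
exists C; split => //.
  move=> n; apply: (sC (@measurable _ (borel T))) (imageT C n) => //; last first.
    exact: sigma_algebra_measurable.
  by move=> _ [p _ <-]; apply: sub_sigma_algebra; exact: oV.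
apply: smallest_sub; first exact: smallest_sigma_algebra.
move=> U oU.
pose I := [set n | C n `<=` U].
rewrite (_ : U = \bigcup_n (if `[< I n >] then C n else set0)).
  have /= := @bigcupT_measurable _ (g_sigma_algebraType (range C)).
  apply => n; case: asboolP => _; last exact: measurable0.
  by apply: sub_sigma_algebra; exists n.
apply/seteqP; split=> [x Ux|x [n _]].
  have [W BW [Wx WU]] := baseB U x oU Ux; have [n _ nW] := BC W BW.
  by exists n => //; case: asboolP => [_|]; [rewrite nW|case; rewrite /I /= nW].
by case: asboolP => // + Cnx; exact.
Qed.

(** * Hahn sets and total variation *)

Section hahn.
Context d (T : measurableType d) (R : realType).

(** A positive set of the signed measure [m1 - m2] whose complement is negative, stated
without forming the difference. *)
Definition hahn_set (m1 m2 : set T -> \bar R) (A : set T) :=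
  [/\ measurable A, forall B, measurable B -> B `<=` A -> m2 B <= m1 B &
      forall B, measurable B -> B `<=` ~` A -> m1 B <= m2 B].

Lemma ex_hahn_set (m1 m2 : {finite_measure set T -> \bar R}) :
  exists A, hahn_set m1 m2 A.
Proof.
have [A [N [[mA A0] [mN N0] AN ANI]]] := Hahn_decomposition
  (cadd (charge_of_finite_measure m1) (copp (charge_of_finite_measure m2))).
exists A; split => // B mB BA.
  have := A0 B mB BA.
  by rewrite /cadd /copp /charge_of_finite_measure /= sube_ge0// fin_num_measure ?orbT.
have BN : B `<=` N.
  by move=> x /BA nAx; have [//|//] : (A `|` N) x by rewrite AN.
have := N0 B mB BN.
by rewrite /cadd /copp /charge_of_finite_measure /= sube_le0.
Qed.

Lemma hahn_set_le_integral (m1 m2 : {measure set T -> \bar R}) (D : set T)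
    (h : T -> \bar R) : measurable D ->
  (forall B, measurable B -> B `<=` D -> m2 B <= m1 B) ->
  measurable_fun [set: T] h -> (forall x, 0 <= h x) ->
  \int[m2]_(x in D) h x <= \int[m1]_(x in D) h x.
Proof.
move=> mD m21 mh h0.
have restrE (m : {measure set T -> \bar R}) :
    \int[m]_(x in D) h x = \int[mrestr m mD]_(x in D) h x.
  by apply: eq_measure_integral => B mB BD; rewrite /= /mrestr setIidl.
rewrite (restrE m1) (restrE m2); apply: ge0_le_measure_integral => // B mB.
by apply: m21; [exact: measurableI|exact: subIsetr].
Qed.

(** Moving from [B] to the Hahn set only adds points where [m1] dominates and only
removes points where [m2] dominates. *)
Lemma hahn_set_integral (m1 m2 : {measure set T -> \bar R}) (A B : set T)
    (h : T -> \bar R) : hahn_set m1 m2 A -> measurable B ->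
  measurable_fun [set: T] h -> (forall x, 0 <= h x) ->
  \int[m1]_(x in B) h x + \int[m2]_(x in A) h x <=
  \int[m1]_(x in A) h x + \int[m2]_(x in B) h x.
Proof.
move=> [mA A12 A21] mB mh h0.
have split_int (m : {measure set T -> \bar R}) (E F : set T) :
    measurable E -> measurable F ->
    \int[m]_(x in E) h x =
    \int[m]_(x in E `&` F) h x + \int[m]_(x in E `\` F) h x.
  move=> mE mF; rewrite -[in LHS](setUIDK E F) ge0_integral_setU//.
  - exact: measurableI.
  - exact: measurableD.
  - exact: measurable_funTS.
  - by apply/disj_setPS => x [[_ Fx] [_]].
rewrite (split_int m1 B A)// (split_int m2 A B)// (split_int m1 A B)//.
rewrite (split_int m2 B A)// (setIC B A) [leLHS]addeACA [leRHS]addeACA.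
rewrite leeD// addeC leeD//.
- apply: hahn_set_le_integral => //; first exact: measurableD.
  by move=> E mE EAB; apply: A12 => // x /EAB[].
- apply: hahn_set_le_integral => //; first exact: measurableD.
  by move=> E mE EAB; apply: A21 => // x /EAB[].
Qed.

(** Add the inequality of [hahn_set_integral] for [h] and [B = setT] to the domination
of the integrals of [c - h] over [A]. All terms are added rather than subtracted, so no measure has
to be finite. *)
Lemma hahn_set_osc (m1 m2 : {measure set T -> \bar R}) (A : set T) (h : T -> R)
    (c : R) : hahn_set m1 m2 A -> measurable_fun [set: T] h ->
  (forall x, 0 <= h x <= c)%R ->
  \int[m1]_x (h x)%:E + c%:E * m2 A <= c%:E * m1 A + \int[m2]_x (h x)%:E.
Proof.
move=> hA mh h0c; have [mA A12 _] := hA.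
have mhE : measurable_fun [set: T] (EFin \o h) by exact/measurable_EFinP.
have mch : measurable_fun [set: T] (fun x => (c - h x)%:E).
  by apply/measurable_EFinP; exact: measurable_funB.
have h0 x : 0 <= (h x)%:E by rewrite lee_fin; case/andP: (h0c x).
have ch0 x : 0 <= (c - h x)%:E by rewrite lee_fin subr_ge0; case/andP: (h0c x).
have cE (m : {measure set T -> \bar R}) :
    c%:E * m A = \int[m]_(x in A) (h x)%:E + \int[m]_(x in A) (c - h x)%:E.
  rewrite -integral_cst// -ge0_integralD//; [|exact: measurable_funTS..].
  by apply: eq_integral => x _; rewrite -EFinD addrC subrK.
rewrite !cE addeA [leRHS]addeAC.
apply: leeD; last exact: hahn_set_le_integral.
exact: hahn_set_integral.
Qed.

Lemma hahn_setC (m1 m2 : set T -> \bar R) (A : set T) :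
  hahn_set m1 m2 A -> hahn_set m2 m1 (~` A).
Proof. by move=> [mA h12 h21]; split; rewrite ?setCK//; exact: measurableC. Qed.

End hahn.

Section total_variation.
Context d (T : measurableType d) (R : realType).
Implicit Types m : {finite_measure set T -> \bar R}.

(** The difference of the integrals of the function equal to [1] on [A] and [-1] off
[A]. *)
Definition tv_set (m1 m2 : set T -> \bar R) (A : set T) : \bar R :=
  2%:E * (m1 A - m2 A) - (m1 setT - m2 setT).

Lemma tv_setE m1 m2 A : measurable A -> tv_set m1 m2 A =
  (2 * (fine (m1 A) - fine (m2 A)) - (fine (m1 setT) - fine (m2 setT)))%:E.
Proof.
move=> mA; rewrite /tv_set -[m1 A]fineK ?fin_num_measure//.
rewrite -[m2 A]fineK ?fin_num_measure// -[m1 setT]fineK ?fin_num_measure//.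
by rewrite -[m2 setT]fineK ?fin_num_measure.
Qed.

Lemma bounded_integrable m (f : T -> R) : measurable_fun [set: T] f ->
  (forall x, `|f x| <= 1)%R -> m.-integrable setT (EFin \o f).
Proof.
move=> mf f1; apply: measurable_bounded_integrable => //.
  by rewrite -ge0_fin_numE// fin_num_measure.
by exists 1%R; split => // x x1 y _; exact: le_trans (f1 y) (ltW x1).
Qed.

Lemma integral_add1 m (f : T -> R) : measurable_fun [set: T] f ->
  (forall x, `|f x| <= 1)%R ->
  \int[m]_x (1 + f x)%:E = (fine (m setT) + fine (\int[m]_x (f x)%:E))%:E.
Proof.
move=> mf f1; have fi := bounded_integrable m mf f1.
under eq_integral do rewrite EFinD.
rewrite (integralD _ _ fi)//; last first.
  apply: (@bounded_integrable m (cst 1%R)) => // x; by rewrite normr1.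
rewrite integral_cst// mul1e EFinD !fineK ?fin_num_measure//.
exact: integrable_fin_num.
Qed.

Lemma tv_dist_ge_set m1 m2 A : measurable A -> tv_set m1 m2 A <= tv_dist m1 m2.
Proof.
move=> mA; pose f x : R := (2 * \1_A x - 1)%R.
have mf : measurable_fun [set: T] f.
  by apply: measurable_funB => //; apply: measurable_funM => //; exact: measurable_indic.
have f1 x : (`|f x| <= 1)%R.
  by rewrite /f indicE; case: (x \in A); rewrite /= ler_norml; lra.
have fE m : \int[m]_x (f x)%:E = (2 * fine (m A) - fine (m setT))%:E.
  have := integral_add1 m mf f1.
  have -> : \int[m]_x (1 + f x)%:E = (2 * fine (m A))%:E.
    transitivity (\int[m]_x (2%:E * (\1_A x)%:E)).
      by apply: eq_integral => x _; rewrite /f -EFinM addrCA subrr addr0.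
    rewrite ge0_integralZl//; last by apply/measurable_EFinP; exact: measurable_indic.
    by rewrite integral_indic// setIT EFinM fineK// fin_num_measure.
  move=> /(congr1 fine) /= ->; rewrite addrC addKr fineK//.
  by apply: integrable_fin_num => //; exact: bounded_integrable.
apply: (@le_trans _ _ `| \int[m1]_x (f x)%:E - \int[m2]_x (f x)%:E |); last first.
  by apply: ereal_sup_ubound; exists f.
rewrite tv_setE// !fE -EFinB abse_EFin lee_fin.
by apply: le_trans (ler_norm _); lra.
Qed.

Lemma tv_dist_ge0 (P P' : set T -> \bar R) : 0 <= tv_dist P P'.
Proof.
apply: (@le_trans _ _ `| \int[P]_x (cst 0%R x)%:E - \int[P']_x (cst 0%R x)%:E |).
  exact: abse_ge0.
by apply: ereal_sup_ubound; exists (cst 0%R) => //; split=> // x; rewrite normr0.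
Qed.

(** The supremum defining the total variation is attained at the sign function of a
Hahn set. *)
Lemma tv_distE m1 m2 A : hahn_set m1 m2 A -> tv_dist m1 m2 = tv_set m1 m2 A.
Proof.
move=> hA; have [mA _ _] := hA; apply/eqP; rewrite eq_le tv_dist_ge_set// andbT.
apply: ge_ereal_sup => _ [f [mf f1] <-].
(* By symmetry in [f] and [- f] no absolute value is needed; [1 + g] takes its values
in [[0, 2]]. *)
have half (g : T -> R) : measurable_fun [set: T] g -> (forall x, `|g x| <= 1)%R ->
    (fine (\int[m1]_x (g x)%:E) - fine (\int[m2]_x (g x)%:E))%:E <= tv_set m1 m2 A.
  move=> mg g1.
  have mg1 : measurable_fun [set: T] (fun x => 1 + g x)%R by exact: measurable_funD.
  have g02 x : (0 <= 1 + g x <= 2)%R by have := g1 x; rewrite ler_norml; lra.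
  have : \int[m1]_x (1 + g x)%:E + 2%:E * m2 A <=
         2%:E * m1 A + \int[m2]_x (1 + g x)%:E := hahn_set_osc hA mg1 g02.
  rewrite !integral_add1// tv_setE//.
  rewrite -[m1 A]fineK ?fin_num_measure// -[m2 A]fineK ?fin_num_measure//.
  by rewrite -!EFinM -!EFinD !lee_fin /=; lra.
have fin m (g : T -> R) : measurable_fun [set: T] g -> (forall x, `|g x| <= 1)%R ->
    \int[m]_x (g x)%:E \is a fin_num.
  by move=> mg g1; apply: integrable_fin_num => //; exact: bounded_integrable.
have fN m : \int[m]_x ((\- f)%R x)%:E = - \int[m]_x (f x)%:E.
  rewrite -mulN1e -integralZl//; last exact: bounded_integrable.
  by apply: eq_integral => x _; rewrite -EFinM mulN1r.
have h1 := half f mf f1.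
have := half _ (measurable_funN mf) (fun x => _); rewrite !fN !fineN => h2.
rewrite -(fineK (fin m1 f mf f1)) -(fineK (fin m2 f mf f1)) -EFinB abse_EFin.
move: h1 h2; rewrite tv_setE// !lee_fin ler_norml => h1 h2.
have {}h2 := h2 (fun x => _); rewrite h1 andbT lerNl; apply: le_trans (h2 _).
  by rewrite opprB addrC opprK.
by move=> x; rewrite /= normrN.
Qed.

Lemma tv_dist_probability (p1 p2 : probability T R) (A : set T) :
  hahn_set p1 p2 A -> tv_dist p1 p2 = (2 * (fine (p1 A) - fine (p2 A)))%:E.
Proof.
move=> hA; have [mA _ _] := hA; rewrite (tv_distE hA) tv_setE//=.
by rewrite !probability_setT subrr subr0.
Qed.

Lemma tv_dist_eq (m1 m2 m1' m2' : {measure set T -> \bar R}) :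
  (forall A, measurable A -> m1 A = m1' A) ->
  (forall A, measurable A -> m2 A = m2' A) -> tv_dist m1 m2 = tv_dist m1' m2'.
Proof.
move=> e1 e2; rewrite /tv_dist; congr ereal_sup.
have i1 f : \int[m1]_x f x = \int[m1']_x f x.
  by apply: eq_measure_integral => A mA _; exact: e1.
have i2 f : \int[m2]_x f x = \int[m2']_x f x.
  by apply: eq_measure_integral => A mA _; exact: e2.
by apply/seteqP; split=> _ [f mf <-]; exists f => //; rewrite i1 i2.
Qed.

End total_variation.

Section measures.
Context d (T : measurableType d) (R : realType).

(** [finite_measureP] and [probabilityP] bundle a measure with its total mass: for a
kernel the mass is known only at a given parameter. *)
Lemma finite_measureP (m : {measure set T -> \bar R}) : m [set: T] < +oo ->
  exists m' : {finite_measure set T -> \bar R}, (m : set T -> \bar R) = m'.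
Proof.
move=> mfin.
have mf : fin_num_fun m by exact: lty_fin_num_fun.
pose H1 := isFinite.Build _ _ _ _ mf.
have msf : sigma_finite setT m.
  by apply: fin_num_fun_sigma_finite => //; rewrite measure0.
pose H2 := isSFinite.Build _ _ _ _ (sfinite_measure_sigma_finite msf).
pose H3 := isSigmaFinite.Build _ _ _ _ msf.
by exists (HB.pack_for (FiniteMeasure.type T R) (Measure.sort m) H1 H2 H3).
Qed.

Lemma probabilityP (m : {measure set T -> \bar R}) : m [set: T] = 1 ->
  exists p : probability T R, (m : set T -> \bar R) = p.
Proof.
move=> m1.
have mf : fin_num_fun m by apply: lty_fin_num_fun; rewrite m1 ltry.
have m_le1 : m [set: T] <= 1 by rewrite m1.
pose H1 := isFinite.Build _ _ _ _ mf.
have msf : sigma_finite setT m.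
  by apply: fin_num_fun_sigma_finite => //; rewrite measure0.
pose H2 := isSFinite.Build _ _ _ _ (sfinite_measure_sigma_finite msf).
pose H3 := isSigmaFinite.Build _ _ _ _ msf.
pose H4 := isSubProbability.Build _ _ _ _ m_le1.
pose H5 := isProbability.Build _ _ _ _ m1.
by exists (HB.pack_for (Probability.type T R) (Measure.sort m) H1 H2 H3 H4 H5).
Qed.

Lemma probability_inhabited (P : probability T R) : exists x : T, True.
Proof.
have [//|T0] := pselect (exists x : T, True).
have := probability_setT P; rewrite (_ : setT = set0) ?measure0; last first.
  by apply/seteqP; split=> // x _; apply: T0; exists x.
by move/eqP; rewrite eq_sym onee_eq0.
Qed.

End measures.

Section measurability.
Context d (T : measurableType d) (R : realType) (C : nat -> set T).
Hypothesis genC : generating_algebra C.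

(** A Hahn set is measurable, hence approximated by members of the algebra. *)
Lemma tv_dist_sup (m1 m2 : {finite_measure set T -> \bar R}) :
  tv_dist m1 m2 = ereal_sup (range (fun n => tv_set m1 m2 (C n))).
Proof.
have [mC _ _ _] := genC; apply/eqP; rewrite eq_le; apply/andP; split; last first.
  by apply: ge_ereal_sup => _ [n _ <-]; exact: tv_dist_ge_set.
have [A hA] := ex_hahn_set m1 m2; have [mA _ _] := hA.
rewrite (tv_distE hA); apply/lee_addgt0Pr => e e0.
have [m mE] : exists m : {finite_measure set T -> \bar R},
    forall E, m E = m1 E + m2 E.
  have /finite_measureP[m mE] : measure_add m1 m2 [set: T] < +oo.
    by rewrite -ge0_fin_numE// measure_addE fin_numD !fin_num_measure.
  by exists m => E; rewrite -mE; exact: measure_addE.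
have e20 : (0 < e / 2)%R by rewrite divr_gt0.
have [n] := generating_algebra_approx m genC mA e20; rewrite !mE => An.
apply: (@le_trans _ _ (tv_set m1 m2 (C n) + e%:E)); last first.
  by rewrite leeD2r//; apply: ereal_sup_ubound; exists n.
have le_diff (m' : {finite_measure set T -> \bar R}) E F :
    measurable E -> measurable F -> (fine (m' E) <= fine (m' F) + fine (m' (E `\` F)))%R.
  move=> mE' mF; rewrite -lee_fin EFinD !fineK ?fin_num_measure//; last exact: measurableD.
  apply: (@le_trans _ _ (m' (F `|` (E `\` F)))).
    apply: le_measure; rewrite ?inE//; first by apply: measurableU => //; exact: measurableD.
    by move=> x Ex; have [Fx|Fx] := pselect (F x); [left|right].
  by apply: measureU2 => //; exact: measurableD.
rewrite !tv_setE// -EFinD lee_fin.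
have := le_diff m1 A (C n) mA (mC n); have := le_diff m2 (C n) A (mC n) mA.
have mAC : measurable (A `\` C n) by exact: measurableD.
have mCA : measurable (C n `\` A) by exact: measurableD.
move: An; rewrite -[m1 (A `\` _)]fineK ?fin_num_measure//.
rewrite -[m2 (A `\` _)]fineK ?fin_num_measure// -[m1 (_ `\` A)]fineK ?fin_num_measure//.
rewrite -[m2 (_ `\` A)]fineK ?fin_num_measure// -!EFinD lte_fin.
have := fine_ge0 (measure_ge0 m1 (C n `\` A)).
by have := fine_ge0 (measure_ge0 m2 (A `\` C n)); lra.
Qed.

Lemma measurable_tv_dist dS (S : measurableType dS) (k1 k2 : R.-fker S ~> T) :
  measurable_fun [set: S] (fun s => tv_dist (k1 s) (k2 s)).
Proof.
have [mC _ _ _] := genC.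
have finP (k : R.-fker S ~> T) s : exists m : {finite_measure set T -> \bar R},
    (k s : set T -> \bar R) = m.
  by apply: finite_measureP; rewrite -ge0_fin_numE// finite_kernel_measure.
rewrite (_ : (fun s => _) =
    fun s => esups (fun n => tv_set (k1 s) (k2 s) (C n)) 0%N); last first.
  apply/funext => s; rewrite /esups /sdrop /=.
  have [m1 ->] := finP k1 s; have [m2 ->] := finP k2 s.
  by rewrite tv_dist_sup; congr ereal_sup; apply/seteqP; split=> _ [n _ <-]; exists n.
apply: measurable_fun_esups => n; rewrite /tv_set.
apply: emeasurable_funB; last by apply: emeasurable_funB; exact: measurable_kernel.
by apply: measurable_funeM; apply: emeasurable_funB; exact: measurable_kernel.
Qed.

(** Measures with no total variation between them are equal, hence agreement on a
generating algebra is enough. *)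
Lemma finite_measure_eq_algebra (m1 m2 : {finite_measure set T -> \bar R}) :
  (forall n, m1 (C n) = m2 (C n)) -> m1 setT = m2 setT ->
  forall A, measurable A -> m1 A = m2 A.
Proof.
move=> m12 m12T A mA.
have tv0 : tv_dist m1 m2 = 0.
  rewrite tv_dist_sup [X in ereal_sup X](_ : _ = [set 0]) ?ereal_sup1//.
  have [mC _ _ _] := genC; apply/seteqP; split=> [_ [n _ <-]|_ ->] /=.
    by rewrite tv_setE// m12 m12T !subrr mulr0 subrr.
  by exists 0%N => //; rewrite tv_setE// m12 m12T !subrr mulr0 subrr.
have tv_le B : measurable B -> tv_set m1 m2 B <= 0.
  by move=> mB; rewrite -tv0 tv_dist_ge_set.
have := tv_le _ mA; have := tv_le _ (measurableC mA).
rewrite !tv_setE//; last exact: measurableC.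
have fC (m : {finite_measure set T -> \bar R}) :
    fine (m (~` A)) = (fine (m setT) - fine (m A))%R.
  rewrite -fineB ?fin_num_measure// -setTD measureD ?setTI//.
  by rewrite -ge0_fin_numE// fin_num_measure.
rewrite !fC m12T !lee_fin => h1 h2.
rewrite -[LHS]fineK ?fin_num_measure// -[RHS]fineK ?fin_num_measure//.
by congr (_%:E); lra.
Qed.

End measurability.

(** * Contraction by a Markov kernel *)

Section contraction.
Context d (S : measurableType d) d' (T : measurableType d') (R : realType).
Variable K : R.-pker S ~> T.

Lemma dobrushin_le_set (x x' : S) (A : set T) : measurable A ->
  dobrushin K <= K x' A + K x (~` A).
Proof.
move=> mA; pose F (i : 'I_2) := if i == ord0 then A else ~` A.
apply: (@le_trans _ _ (\sum_(i < 2) Order.min (K x (F i)) (K x' (F i)))).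
  apply: ereal_inf_lbound; exists x, x', 2%N, F; split => //; split.
  - by move=> i; rewrite /F; case: ifP => _ //; exact: measurableC.
  - apply/trivIsetP => -[[|[|//]] i2] [[|[|//]] j2] _ _ //= _.
      by rewrite /F /= setICr.
    by rewrite /F /= setICl.
  - apply/seteqP; split=> // y _; have [Ay|nAy] := pselect (A y).
      by exists ord0.
    by exists (lift ord0 ord0).
rewrite big_ord_recl big_ord1 /F /=; apply: leeD.
  by rewrite ge_min lexx orbT.
by rewrite ge_min lexx.
Qed.

Lemma dobrushin_ge0 : 0 <= dobrushin K.
Proof.
apply: le_ereal_inf_tmp => _ [x [x' [m [A [_ ->]]]]].
by apply: sume_ge0 => i _; rewrite le_min !measure_ge0.
Qed.

Lemma dobrushin_le1 (x : S) : dobrushin K <= 1.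
Proof.
have := dobrushin_le_set x x measurableT.
by rewrite setCT measure0 adde0 prob_kernel.
Qed.

Lemma dobrushin_fin_num (x : S) : dobrushin K \is a fin_num.
Proof.
by rewrite ge0_fin_numE ?dobrushin_ge0// (le_lt_trans (dobrushin_le1 x))// ltry.
Qed.

Lemma kernel_le1 x A : measurable A -> K x A <= 1.
Proof.
by move=> mA; rewrite -(@prob_kernel _ _ _ _ _ K x) le_measure ?inE.
Qed.

(** The values [K x B] differ by at most [1 - dobrushin K], because the partition
[{B, ~` B}] competes in the infimum; a function of small oscillation separates two
measures at most by its oscillation times their distance. *)
Lemma integral_kernel_le (P1 P2 : probability S R) A B :
  hahn_set P1 P2 A -> measurable B ->
  \int[P1]_x K x B + (1 - dobrushin K) * P2 A <=
  (1 - dobrushin K) * P1 A + \int[P2]_x K x B.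
Proof.
move=> hA mB; have [x0 _] := probability_inhabited P1.
have dfin := dobrushin_fin_num x0.
pose f x := fine (K x B).
have Kfin x E : measurable E -> K x E \is a fin_num.
  by move=> mE; rewrite ge0_fin_numE// (le_lt_trans (kernel_le1 x mE))// ltry.
have fE x : K x B = (f x)%:E by rewrite /f fineK// Kfin.
have mf : measurable_fun [set: S] f.
  apply/measurable_EFinP; rewrite (_ : EFin \o f = K ^~ B); first exact: measurable_kernel.
  by apply/funext => x /=; rewrite fE.
pose c := (1 - fine (dobrushin K))%R.
have cE : 1 - dobrushin K = c%:E by rewrite -[dobrushin K]fineK.
have f_osc x x' : (f x - f x' <= c)%R.
  have := dobrushin_le_set x x' mB.
  have -> : K x (~` B) = (1 - f x)%:E.
    rewrite EFinB -fE -(@prob_kernel _ _ _ _ _ K x) -setTD measureD ?setTI//.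
    by rewrite -ge0_fin_numE// Kfin.
  by rewrite fE -[dobrushin K]fineK// -EFinD lee_fin /c; lra.
(* Subtracting the infimum leaves a function with values in [[0, c]]. *)
pose m := inf (range f).
have hinf : has_inf (range f).
  split; first by exists (f x0), x0.
  by exists 0%R => _ [x _ <-]; rewrite fine_ge0.
have m_le x : (m <= f x)%R by apply: ge_inf; [case: hinf|exists x].
have h0c x : (0 <= f x - m <= c)%R.
  rewrite subr_ge0 m_le/= lerBlDr -lerBlDl; apply: lb_le_inf; first by case: hinf.
  by move=> _ [x' _ <-]; have := f_osc x x'; lra.
have mfm : measurable_fun [set: S] (fun x => f x - m)%R by exact: measurable_funB.
have iE (P : probability S R) :
    \int[P]_x K x B = \int[P]_x (f x - m)%:E + m%:E.
  have m0 : (0 <= m)%R by apply: lb_le_inf; [case: hinf|move=> _ [x _ <-]; rewrite fine_ge0].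
  rewrite -[X in _ = _ + X]mule1 -(@probability_setT _ _ _ P) -integral_cst//.
  rewrite -ge0_integralD//.
  - by apply: eq_integral => x _; rewrite -EFinD subrK fE.
  - by move=> x _; rewrite lee_fin; case/andP: (h0c x).
  - exact/measurable_EFinP.
have h : \int[P1]_x (f x - m)%:E + c%:E * P2 A <=
       c%:E * P1 A + \int[P2]_x (f x - m)%:E := hahn_set_osc hA mfm h0c.
rewrite !iE cE (addeAC (\int[P1]_x _)) addeA.
by apply: leeD h _.
Qed.

End contraction.

(** * The Bayes update as a kernel *)

Section kernels.
Context d (S : measurableType d) d' (T : measurableType d') (R : realType).
Variable k : S -> {measure set T -> \bar R}.
Hypothesis mk : forall A, measurable A -> measurable_fun [set: S] (k ^~ A).

(* Canonical structures need a constant as their head, so [k] is given an alias for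
each structure. *)
Let K := k.
HB.instance Definition _ := isKernel.Build _ _ _ _ _ K mk.

Section probability.
Hypothesis k1 : forall s, k s [set: T] = 1.
Let Kp := K.
HB.instance Definition _ := Kernel.on Kp.
HB.instance Definition _ := Kernel_isProbability.Build _ _ _ _ _ Kp k1.

Lemma ex_pker : exists k' : R.-pker S ~> T, forall s, k' s = k s.
Proof. by exists Kp. Qed.
End probability.

Section subprobability.
Hypothesis k1 : forall s, k s [set: T] <= 1.
Let Ks := K.
HB.instance Definition _ := Kernel.on Ks.
Let Ks_le1 : ereal_sup [set Ks s [set: T] | s in [set: S]] <= 1.
Proof. by apply: ge_ereal_sup => _ [s _ <-]; exact: k1. Qed.
HB.instance Definition _ := Kernel_isSubProbability.Build _ _ _ _ _ Ks Ks_le1.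

Lemma ex_spker : exists k' : R.-spker S ~> T, forall s, k' s = k s.
Proof. by exists Ks. Qed.
End subprobability.

End kernels.

Section bayes_measure.
Context (R : realType) dX dY (X : measurableType dX) (Y : measurableType dY).
Variable g : X * Y -> R.
Hypotheses (mg : measurable_fun [set: X * Y] g) (g0 : forall xy, (0 <= g xy)%R).

Local Notation lik m B y := (\int[m]_(x in B) (g (x, y))%:E).

Lemma lik_ge0 (m : {measure set X -> \bar R}) B y : 0 <= lik m B y.
Proof. by apply: integral_ge0 => x _; rewrite lee_fin. Qed.

Lemma measurable_lik_snd y (B : set X) : measurable_fun B (fun x => (g (x, y))%:E).
Proof.
apply: measurable_funTS; apply/measurable_EFinP.
exact: measurableT_comp mg (measurable_pair2 y).
Qed.

(** Dividing by an evidence that is null or infinite gives the null measure, and so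
does multiplying by this real power of its finite part. *)
Lemma bayes_updateE (m : {measure set X -> \bar R}) y A : bayes_update g m y A =
  (fine (lik m [set: X] y) `^ (-1))%:E * lik m A y.
Proof.
rewrite /bayes_update; have := lik_ge0 m setT y.
case: (lik m setT y) => [e| |] //; last first.
  by move=> _; rewrite ltry /inve mule0 powR0 ?mul0e// oppr_eq0 oner_eq0.
rewrite lee_fin le_eqVlt => /predU1P[<-|e0].
  by rewrite ltxx /= powR0 ?mul0e// oppr_eq0 oner_eq0.
by rewrite lte_fin e0 /inve gt_eqF//= powR_inv1 ?ltW// muleC.
Qed.

Lemma lik_semi_sigma_additive (m : {measure set X -> \bar R}) y :
  semi_sigma_additive (fun A => lik m A y).
Proof.
move=> F mF tF mUF; rewrite ge0_integral_bigcup//;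
  [|exact: measurable_lik_snd|by move=> x _; rewrite lee_fin].
apply: is_cvg_ereal_nneg_natsum_cond => n _ _; exact: lik_ge0.
Qed.

Lemma lik_subset_le (m : {measure set X -> \bar R}) y (A B : set X) :
  measurable A -> measurable B -> A `<=` B -> lik m A y <= lik m B y.
Proof.
move=> mA mB AB; apply: ge0_subset_integral => //; first exact: measurable_lik_snd.
by move=> x _; rewrite lee_fin.
Qed.

(** The two proof arguments let unification find the measure structure declared
below. *)
Definition bayes_measure (_ : measurable_fun [set: X * Y] g)
    (_ : forall xy, (0 <= g xy)%R) (m : {measure set X -> \bar R}) (y : Y) :=
  bayes_update g m y.

Section instances.
Variables (m : {measure set X -> \bar R}) (y : Y).
Local Notation b := (bayes_measure mg g0 m y).

Let b0 : b set0 = 0.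
Proof. by rewrite /bayes_measure bayes_updateE integral_set0 mule0. Qed.

Let b_ge0 A : 0 <= b A.
Proof.
by rewrite /bayes_measure bayes_updateE mule_ge0 ?lee_fin ?powR_ge0 ?lik_ge0.
Qed.

Let b_sigma_additive : semi_sigma_additive b.
Proof.
move=> F mF tF mUF; rewrite /bayes_measure bayes_updateE.
rewrite (_ : (fun n => _) = fun n => (fine (lik m [set: X] y) `^ (-1))%:E *
    \sum_(0 <= i < n) lik m (F i) y); last first.
  apply/funext => n; rewrite ge0_sume_distrr; last by move=> i _; exact: lik_ge0.
  by apply: eq_bigr => i _; rewrite bayes_updateE.
by apply: cvgeZl => //; exact: lik_semi_sigma_additive.
Qed.

HB.instance Definition _ := isMeasure.Build _ _ _ b b0 b_ge0 b_sigma_additive.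

End instances.

Lemma bayes_measure_le1 m y : bayes_measure mg g0 m y [set: X] <= 1.
Proof.
rewrite /bayes_measure bayes_updateE; have := lik_ge0 m setT y.
case: (lik m setT y) => [e| |] //; last first.
  by move=> _; rewrite /= powR0 ?mul0e// oppr_eq0 oner_eq0.
rewrite lee_fin => e_ge0; have [->|e0] := eqVneq e 0%R; first by rewrite mule0.
by rewrite /= powR_inv1// -EFinM mulVf.
Qed.

Section kernel.
Context dS (S : measurableType dS).
Variable k : R.-spker S ~> X.

Lemma measurable_lik B : measurable B ->
  measurable_fun [set: S * Y] (fun p => lik (k p.1) B p.2).
Proof.
move=> mB.
pose F (q : (S * Y) * X) : \bar R := (\1_B q.2 * g (q.2, q.1.2))%:E.
have mF : measurable_fun [set: (S * Y) * X] F.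
  apply/measurable_EFinP; apply: measurable_funM.
    by apply: measurableT_comp; [exact: measurable_indic|exact: measurable_snd].
  apply: (measurableT_comp mg); apply: measurable_fun_pair => //.
  exact: measurableT_comp measurable_snd measurable_fst.
rewrite (_ : (fun p => _) = fun p => \int[k p.1]_x F (p, x)); last first.
  apply/funext => p; rewrite integral_mkcond; apply: eq_integral => x _.
  by rewrite /F patchE indicE; case: ifPn => xB; rewrite ?mul1r ?mul0r.
have mk A : measurable A -> measurable_fun [set: S * Y] (fun p => k p.1 A).
  by move=> mA; exact: measurableT_comp (measurable_kernel k A mA) measurable_fst.
have [k' k'E] := ex_spker mk (fun p => sprob_kernel_le1 k p.1).
under eq_fun do rewrite -k'E.
apply: measurable_fun_integral_finite_kernel => // q.
by rewrite lee_fin mulr_ge0.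
Qed.

Lemma ex_bayes_kernel : exists b : R.-spker (S * Y) ~> X,
  forall s y, (b (s, y) : set X -> \bar R) = bayes_update g (k s) y.
Proof.
have mb A : measurable A -> measurable_fun [set: S * Y]
    (fun p => bayes_measure mg g0 (k p.1) p.2 A).
  move=> mA; rewrite /bayes_measure; under eq_fun do rewrite bayes_updateE.
  apply: emeasurable_funM; last exact: measurable_lik.
  apply/measurable_EFinP; apply: (measurableT_comp (measurable_powR _)).
  by apply: measurableT_comp => //; exact: measurable_lik.
have [b bE] := ex_spker mb (fun p => bayes_measure_le1 (k p.1) p.2).
by exists b => s y; rewrite bE.
Qed.

End kernel.

End bayes_measure.

(** * Expansion by the Bayes update *)

Section update.
Context (R : realType) dX dY (X : measurableType dX) (Y : measurableType dY).
Variables (Q : R.-pker X ~> Y) (lambda : probability Y R) (g : X * Y -> R).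
Hypothesis likg : is_likelihood Q lambda g.

Let mg : measurable_fun [set: X * Y] g. Proof. by case: likg. Qed.
Let g0 xy : (0 <= g xy)%R. Proof. by case: likg. Qed.

Local Notation lik m B y := (\int[m]_(x in B) (g (x, y))%:E).

(** Tonelli, with [Q x] in the place of the integral of its density. For [B] the whole
space the right-hand side is the law of the observation at [D]. *)
Lemma integral_lik (m : probability X R) B D :
  measurable B -> measurable D ->
  \int[lambda]_(y in D) lik m B y = \int[m]_(x in B) Q x D.
Proof.
move=> mB mD; have [_ _ Qg] := likg.
pose F (p : X * Y) : \bar R := (\1_B p.1 * (\1_D p.2 * g p))%:E.
have mF : measurable_fun [set: X * Y] F.
  apply/measurable_EFinP; apply: measurable_funM.
    by apply: measurableT_comp; [exact: measurable_indic|exact: measurable_fst].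
  apply: measurable_funM => //.
  by apply: measurableT_comp; [exact: measurable_indic|exact: measurable_snd].
have F0 p : 0 <= F p by rewrite lee_fin !mulr_ge0.
transitivity (\int[lambda]_y \int[m]_x F (x, y)).
  rewrite integral_mkcond; apply: eq_integral => y _.
  rewrite patchE; case: ifPn => yD.
    rewrite integral_mkcond; apply: eq_integral => x _.
    by rewrite patchE /F !indicE yD /=; case: ifPn; rewrite ?mul1r ?mul0r.
  by rewrite integral0_eq// => x _; rewrite /F !indicE (negbTE yD) mul0r mulr0.
rewrite -sfinite_Fubini// [RHS]integral_mkcond; apply: eq_integral => x _.
rewrite patchE; case: ifPn => xB.
  rewrite Qg// [RHS]integral_mkcond; apply: eq_integral => y _.
  by rewrite patchE /F !indicE xB /=; case: ifPn; rewrite mul1r ?mul1r ?mul0r.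
by rewrite integral0_eq// => y _; rewrite /F !indicE (negbTE xB) mul0r.
Qed.

Lemma measurable_lik1 (m : probability X R) B : measurable B ->
  measurable_fun [set: Y] (fun y => lik m B y).
Proof.
move=> mB.
have [k kE] := @ex_spker _ unit _ X R (fun=> m) (fun=> fun=> measurable_cst _)
  (fun=> sprobability_setT).
have := measurable_lik mg g0 k mB.
by move=> /(measurable_fun_pair2 tt); under eq_fun do rewrite kE.
Qed.

Lemma lik_lty_ae (m : probability X R) : {ae lambda, forall y, lik m [set: X] y < +oo}.
Proof.
have := @integrable_ae _ _ _ lambda setT measurableT (fun y => lik m [set: X] y).
have mlik := measurable_lik1 m measurableT.
have lik0 y : 0 <= lik m [set: X] y by exact: lik_ge0.
move=> h; have : lambda.-integrable setT (fun y => lik m [set: X] y).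
  apply/integrableP; split => //; under eq_integral do rewrite gee0_abs//.
  rewrite integral_lik//; under eq_integral do rewrite prob_kernel.
  by rewrite integral_cst// mul1e /= probability_setT  ltry.
move=> /h; apply: filterS => y /(_ I).
by rewrite ge0_fin_numE.
Qed.

Lemma lik_dominates (m1 m2 : {measure set X -> \bar R}) B y : measurable B ->
  m1 `<< m2 -> lik m2 B y = 0 -> lik m1 B y = 0.
Proof.
move=> mB m12; have mgy := @measurable_lik_snd _ _ _ _ _ _ mg y B.
have abs (m : {measure set X -> \bar R}) :
    lik m B y = \int[m]_(x in B) `|(g (x, y))%:E|.
  by apply: eq_integral => x _; rewrite gee0_abs// lee_fin.
rewrite !abs => /(ae_eq_integral_abs _ mB mgy) h.
by apply/(ae_eq_integral_abs _ mB mgy); exact: null_dominates_ae_eq h.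
Qed.

Lemma bayes_update_setT (m : {measure set X -> \bar R}) y :
  0 < lik m [set: X] y < +oo -> bayes_update g m y [set: X] = 1.
Proof.
move=> /andP[l0 loo]; rewrite /bayes_update l0.
have lfin : lik m [set: X] y \is a fin_num by rewrite ge0_fin_numE// ltW.
by rewrite divee ?gt_eqF.
Qed.

Lemma bayes_update_dominates (m1 m2 : {measure set X -> \bar R}) y :
  m1 `<< m2 -> 0 < lik m2 [set: X] y < +oo ->
  bayes_update g m1 y `<< bayes_update g m2 y.
Proof.
move=> m12 /andP[l0 loo] A A0 B mB BA.
rewrite (bayes_updateE g0); suff -> : lik m1 B y = 0 by rewrite mule0.
apply: (lik_dominates mB m12).
have := A0 B mB BA; rewrite (bayes_updateE g0) => /eqP.
rewrite mule_eq0 => /orP[|/eqP//].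
rewrite eqe powR_eq0 oppr_eq0 oner_eq0 andbT fine_eq0.
  by rewrite gt_eqF.
by rewrite ge0_fin_numE// ltW.
Qed.

Lemma hahn_set_lik (m1 m2 : {measure set X -> \bar R}) A B y :
  hahn_set m1 m2 A -> measurable B ->
  lik m1 B y + lik m2 A y <= lik m1 A y + lik m2 B y.
Proof.
move=> hA mB; apply: hahn_set_integral => //; last by move=> x; rewrite lee_fin.
exact: measurable_lik_snd.
Qed.

(** Two posteriors differ because the priors do and because the evidences that
normalise them do. *)
Lemma bayes_update_tv_pointwise (s1 s2 : probability X R) A
    (B : set Y) y :
  s1 `<< s2 -> hahn_set s1 s2 A ->
  lik s1 [set: X] y < +oo -> lik s2 [set: X] y < +oo ->
  (B y <-> lik s1 [set: X] y < lik s2 [set: X] y) ->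
  lik s1 [set: X] y * tv_dist (bayes_update g s1 y) (bayes_update g s2 y) +
    (2%:E * lik s2 A y + 2%:E * ((fun y => lik s1 [set: X] y) \_ B) y) <=
  2%:E * lik s1 A y + 2%:E * ((fun y => lik s2 [set: X] y) \_ B) y.
Proof.
move=> s12 hA n1oo n2oo B12; have [mA _ _] := hA.
have lik_fin (s : probability X R) D : measurable D -> lik s [set: X] y < +oo ->
    exists2 r : R, lik s D y = r%:E & (0 <= r)%R.
  move=> mD soo; have sD : lik s D y < +oo.
    by apply: le_lt_trans soo; exact: lik_subset_le.
  have := lik_ge0 g0 s D y; have := sD; case: (lik s D y) => // r _ r0.
  by exists r; rewrite // -lee_fin.
have [n1 n1E n1_0] := lik_fin s1 _ measurableT n1oo.
have [n2 n2E n2_0] := lik_fin s2 _ measurableT n2oo.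
have [G1 G1E G1_0] := lik_fin s1 _ mA n1oo.
have [G2 G2E G2_0] := lik_fin s2 _ mA n2oo.
have le_lik (s : probability X R) D : measurable D -> lik s D y <= lik s [set: X] y.
  by move=> mD; exact: lik_subset_le.
have BE : (y \in B) = (n1 < n2)%R.
  apply/idP/idP; rewrite inE; first by move=> /B12; rewrite n1E n2E lte_fin.
  by move=> n12; apply/B12; rewrite n1E n2E lte_fin.
rewrite !patchE BE.
have G2n2 : (G2 <= n2)%R by have := le_lik s2 A mA; rewrite G2E n2E lee_fin.
have [n1z|n1z] := eqVneq n1 0%R.
  rewrite n1E n2E G1E G2E n1z mul0e add0e.
  by case: ltP => ?; rewrite -!EFinM -!EFinD lee_fin; lra.
have n1_gt0 : (0 < n1)%R by rewrite lt0r n1z.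
have n2_gt0 : (0 < n2)%R.
  rewrite lt0r n2_0 andbT; apply: contra n1z => /eqP n2z.
  have : lik s1 [set: X] y = 0.
    by apply: (lik_dominates measurableT s12); rewrite n2E n2z.
  by rewrite n1E => -[->].
have posterior (s : probability X R) n : lik s [set: X] y = n%:E -> (0 < n)%R ->
    exists p : probability X R, (bayes_update g s y : set X -> \bar R) = p.
  move=> sE n_gt0; have [|p pE] := @probabilityP _ _ _ (bayes_measure mg g0 s y).
    by apply: bayes_update_setT; rewrite sE lte_fin n_gt0 ltry.
  by exists p; rewrite -pE.
have [p1 p1E] := posterior s1 n1 n1E n1_gt0.
have [p2 p2E] := posterior s2 n2 n2E n2_gt0.
(* With [p := p2 A'], half of the weighted distance is [G1' - n1 * p], and [G2'] is
[n2 * p]; the inequality follows from [hG] and [0 <= p <= 1]. *)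
have [A' hA'] := ex_hahn_set p1 p2; have [mA' _ _] := hA'.
rewrite p1E p2E (tv_dist_probability hA').
have [G1' G1'E _] := lik_fin s1 _ mA' n1oo.
have [G2' G2'E _] := lik_fin s2 _ mA' n2oo.
have p1A : fine (p1 A') = (G1' / n1)%R.
  by rewrite -p1E (bayes_updateE g0) n1E G1'E /= powR_inv1// mulrC.
have p2A : fine (p2 A') = (G2' / n2)%R.
  by rewrite -p2E (bayes_updateE g0) n2E G2'E /= powR_inv1// mulrC.
have p2A_ge0 : (0 <= fine (p2 A'))%R by rewrite fine_ge0.
have p2A_le1 : (fine (p2 A') <= 1)%R.
  by rewrite -lee_fin fineK ?fin_num_measure// probability_le1.
have hG : (G1' + G2 <= G1 + G2')%R.
  by have := hahn_set_lik y hA mA'; rewrite G1E G2E G1'E G2'E -!EFinD lee_fin.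
have e1 : (n1 * (G1' / n1) = G1')%R by rewrite mulrCA divff// mulr1.
have e2 : (G2' = n2 * fine (p2 A'))%R.
  by rewrite p2A mulrCA divff ?mulr1// gt_eqF.
have e3 : (n1 * (2 * (G1' / n1 - fine (p2 A'))) = 2 * G1' - 2 * (n1 * fine (p2 A')))%R.
  by rewrite mulrCA mulrBr e1 mulrBr.
rewrite n1E n2E G1E G2E p1A.
have [n12|n21] := ltP n1 n2; rewrite -!EFinM -!EFinD lee_fin e3.
  have : (n2 * fine (p2 A') - n1 * fine (p2 A') <= n2 - n1)%R.
    by rewrite -mulrBl ler_piMr// subr_ge0 ltW.
  lra.
have : (n2 * fine (p2 A') <= n1 * fine (p2 A'))%R by exact: ler_wpM2r.
lra.
Qed.

(** Integrating [bayes_update_tv_pointwise] turns the likelihood-weighted masses of a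
Hahn set of the priors into their distance. The evidences integrate over [B] to the laws
[q s1], [q s2] of the observation at [B], to which [integral_kernel_le] applies: hence
the two summands [1] and [1 - dobrushin Q] of the constant. *)
Lemma bayes_update_tv (C : nat -> set X) (s1 s2 : probability X R) :
  generating_algebra C -> s1 `<< s2 ->
  \int[lambda]_y (lik s1 [set: X] y *
    tv_dist (bayes_update g s1 y) (bayes_update g s2 y)) <=
  (2%:E - dobrushin Q) * tv_dist s1 s2.
Proof.
move=> genC s12; have [A hA] := ex_hahn_set s1 s2; have [mA _ _] := hA.
pose B := [set y | lik s1 [set: X] y < lik s2 [set: X] y].
have mB : measurable B.
  rewrite -[B]setTI; apply: measurable_lte => //; exact: measurable_lik1.
have mtv : measurable_fun [set: Y]
    (fun y => tv_dist (bayes_update g s1 y) (bayes_update g s2 y)).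
  have ker (s : probability X R) : exists b : R.-spker Y ~> X,
      forall y, (b y : set X -> \bar R) = bayes_update g s y.
    have [k kE] := @ex_spker _ unit _ X R (fun=> s) (fun=> fun=> measurable_cst _)
      (fun=> sprobability_setT).
    have [b bE] := ex_bayes_kernel mg g0 k.
    have mb D : measurable D -> measurable_fun [set: Y] (fun y => b (tt, y) D).
      by move=> mD; exact: measurable_fun_pair2 (measurable_kernel b D mD).
    have [b' b'E] := ex_spker mb (fun y => sprob_kernel_le1 b (tt, y)).
    by exists b' => y; rewrite b'E bE kE.
  have [b1 b1E] := ker s1; have [b2 b2E] := ker s2.
  under eq_fun do rewrite -b1E -b2E.
  exact: (measurable_tv_dist genC b1 b2).
have tv_ge0 y : 0 <= tv_dist (bayes_update g s1 y) (bayes_update g s2 y).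
  exact: tv_dist_ge0.
have mlik (s : probability X R) D : measurable D ->
  measurable_fun [set: Y] (fun y => lik s D y) := @measurable_lik1 s D.
have lik0 (s : probability X R) D y : 0 <= lik s D y by exact: lik_ge0.
have mpatch (s : probability X R) :
    measurable_fun [set: Y] ((fun y => lik s [set: X] y) \_ B).
  by apply/(measurable_restrictT _ mB); apply: measurable_funTS; exact: mlik.
have patch0 (s : probability X R) y : 0 <= ((fun y => lik s [set: X] y) \_ B) y.
  by apply: erestrict_ge0.
pose I := \int[lambda]_y (lik s1 [set: X] y *
    tv_dist (bayes_update g s1 y) (bayes_update g s2 y)).
pose q (s : probability X R) := \int[s]_x Q x B.
have key : I + (2%:E * s2 A + 2%:E * q s1) <= 2%:E * s1 A + 2%:E * q s2.
  have sA (s : probability X R) : s A = \int[lambda]_y lik s A y.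
    rewrite integral_lik//; under eq_integral do rewrite prob_kernel.
    by rewrite integral_cst// mul1e.
  have qE (s : probability X R) :
      q s = \int[lambda]_y ((fun y => lik s [set: X] y) \_ B) y.
    by rewrite -integral_mkcond integral_lik.
  have mG (s : probability X R) : measurable_fun [set: Y] (fun y => 2%:E * lik s A y).
    by apply: measurable_funeM; exact: mlik.
  have mP (s : probability X R) : measurable_fun [set: Y]
      (fun y => 2%:E * ((fun y => lik s [set: X] y) \_ B) y).
    exact: measurable_funeM.
  have G0 (s : probability X R) y : 0 <= 2%:E * lik s A y by rewrite mule_ge0.
  have P0 (s : probability X R) y : 0 <= 2%:E * ((fun y => lik s [set: X] y) \_ B) y.
    by rewrite mule_ge0.
  have mI : measurable_fun [set: Y] (fun y => lik s1 [set: X] y *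
      tv_dist (bayes_update g s1 y) (bayes_update g s2 y)).
    by apply: emeasurable_funM => //; exact: mlik.
  have I0 y : 0 <= lik s1 [set: X] y *
      tv_dist (bayes_update g s1 y) (bayes_update g s2 y) by rewrite mule_ge0.
  rewrite /I !sA !qE -!ge0_integralZl//; [|by move=> *; exact: mlik..].
  rewrite -!ge0_integralD//; [|by move=> y _; rewrite adde_ge0|exact: emeasurable_funD].
  apply: ae_ge0_le_integral => //.
  - by move=> y _; rewrite !adde_ge0.
  - by do 2![apply: emeasurable_funD => //].
  - by move=> y _; rewrite adde_ge0.
  - exact: emeasurable_funD.
  have := lik_lty_ae s2; have := lik_lty_ae s1.
  apply: filterS2 => y n1oo n2oo _.
  exact: bayes_update_tv_pointwise.
(* On [B] the second law is the larger one, so the roles of the priors are exchanged. *)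
have hAC := hahn_setC hA.
have := integral_kernel_le Q hAC mB; rewrite -/(q s1) -/(q s2) => q21.
have fin (s : probability X R) D : measurable D -> s D \is a fin_num.
  by move=> mD; exact: fin_num_measure.
have sC (s : probability X R) : s (~` A) = (1 - fine (s A))%:E.
  by rewrite probability_setC// EFinB fineK// fin.
have qfin (s : probability X R) : q s \is a fin_num.
  rewrite ge0_fin_numE; last by apply: integral_ge0.
  apply: (@le_lt_trans _ _ (\int[s]_x (cst 1 x))); last first.
    by rewrite integral_cst// mul1e /= probability_setT ltry.
  apply: ge0_le_integral => //; first exact: measurable_kernel.
  by move=> x _; exact: kernel_le1.
have [x0 _] := probability_inhabited s1.
have dfin := dobrushin_fin_num Q x0.
have I0 : 0 <= I by apply: integral_ge0 => y _; rewrite mule_ge0.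
rewrite -/I (tv_dist_probability hA); move: key q21 I0; rewrite !sC.
rewrite -(fineK (qfin s1)) -(fineK (qfin s2)) -(fineK (fin s1 A mA)).
rewrite -(fineK (fin s2 A mA)) -(fineK dfin).
case: I => [r| |] //.
rewrite -!EFinB -!EFinM -!EFinD !lee_fin /= => h1 h2 _.
by nra.
Qed.

End update.

(** * Conditional laws *)

Lemma ex_pushforward d d' (S : measurableType d) (T : measurableType d')
    (R : realType) (m : {measure set S -> \bar R}) (f : S -> T) :
  measurable_fun [set: S] f ->
  exists m' : {measure set T -> \bar R}, (m' : set T -> \bar R) = pushforward m f.
Proof.
move=> mf.
by exists (measure_function_pushforward__canonical__measure_function_Measure m mf).
Qed.

Lemma mem_preimage (S T : Type) (f : S -> T) (A : set T) x :
  (x \in f @^-1` A) = (f x \in A).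
Proof. by apply/idP/idP; rewrite !inE. Qed.

Section conditional_law.
Context (R : realType) dO (Omega : measurableType dO) (P : probability Omega R).

Lemma measurable_preimage d (S : measurableType d) (W : Omega -> S) A :
  measurable_fun [set: Omega] W -> measurable A -> measurable (W @^-1` A).
Proof. by move=> mW mA; rewrite -[_ @^-1` _]setTI; exact: mW. Qed.

(** A conditional law disintegrates the joint law: this holds by definition on
rectangles, hence everywhere. *)
Lemma cond_law_integral d d' (S : measurableType d) (S' : measurableType d')
    (W : Omega -> S) (Z : Omega -> S') (k : R.-pker S ~> S')
    (F : S * S' -> \bar R) :
  measurable_fun [set: Omega] W -> measurable_fun [set: Omega] Z ->
  cond_law P W Z k -> (forall p, 0 <= F p) -> measurable_fun [set: S * S'] F ->
  \int[P]_w F (W w, Z w) = \int[P]_w \int[k (W w)]_z F (W w, z).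
Proof.
move=> mW mZ WZk F0 mF.
have mWZ : measurable_fun [set: Omega] (fun w => (W w, Z w)) by exact: measurable_fun_pair.
have [l lE] := @ex_spker _ unit _ Omega R (fun=> P) (fun=> fun=> measurable_cst _)
  (fun=> sprobability_setT).
(* The joint law is [P] composed with the kernel sending [w] to the law of
[(W w, z)] for [z] drawn from [k (W w)]. *)
have [j jE] : exists j : R.-spker (unit * Omega) ~> (S * S')%type,
    forall u w, (j (u, w) : set _ -> \bar R) = pushforward (k (W w)) (pair (W w)).
  have [j0 j0E] : exists j0 : Omega -> {measure set (S * S') -> \bar R},
      forall w, (j0 w : set _ -> \bar R) = pushforward (k (W w)) (pair (W w)).
    have ex w := @ex_pushforward _ _ _ _ _ (k (W w)) (pair (W w)) (measurable_pair1 _).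
    by exists (fun w => projT1 (cid (ex w))) => w; exact: projT2 (cid (ex w)).
  have mj A : measurable A -> measurable_fun [set: unit * Omega] (fun p => j0 p.2 A).
    move=> mA.
    have mkA : measurable_fun [set: S] (fun s => k s (xsection A s)).
      by apply: measurable_fun_xsection_finite_kernel; rewrite inE.
    rewrite (_ : (fun p => _) = (fun s => k s (xsection A s)) \o (W \o snd)).
      by apply: (measurableT_comp mkA); exact: measurableT_comp.
    by apply/funext => p /=; rewrite j0E /pushforward xsectionE.
  have [|j jE] := ex_spker mj.
    by move=> p; rewrite j0E /pushforward preimage_setT prob_kernel.
  by exists j => u w; rewrite jE j0E.
have [m1 m1E] := ex_pushforward P mWZ.
pose m2 := mkcomp l j tt.
have m12 A : measurable A -> m1 A = m2 A.
  pose G : set (set (S * S')) := [set A `*` B | A in measurable & B in measurable].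
  apply: (measure_unique G (fun=> setT)) => //.
  - exact: measurable_prod_measurableType.
  - move=> _ _ [A1 mA1 [A2 mA2 <-]] [B1 mB1 [B2 mB2 <-]]; rewrite -setXI.
    by exists (A1 `&` B1); [exact: measurableI|exists (A2 `&` B2) => //; exact: measurableI].
  - by move=> _; exists setT => //; exists setT => //; rewrite setXTT.
  - by apply/seteqP; split=> // x _; exists 0%N.
  - move=> _ [A1 mA1 [A2 mA2 <-]]; rewrite m1E /pushforward.
    transitivity (\int[P]_(w in W @^-1` A1) k (W w) A2); first exact: WZk.
    rewrite /m2 /= /kcomp lE [LHS]integral_mkcond.
    apply: eq_integral => w _.
    rewrite jE /pushforward patchE; case: ifPn => [|nA].
      rewrite inE /= => A1w; congr (k _ _); apply/seteqP.
      by split=> [z|z []//]; split.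
    rewrite (_ : _ @^-1` _ = set0) ?measure0//; apply/seteqP; split=> // z [/= A1w _].
    by move: nA; rewrite notin_setE; apply.
  - move=> _; rewrite m1E /pushforward preimage_setT /= probability_setT; exact: ltry.
transitivity (\int[m1]_p F p).
  by rewrite m1E ge0_integral_pushforward.
rewrite (eq_measure_integral m2) => [|A mA _]; last exact: m12.
transitivity (\int[l tt]_w \int[j (tt, w)]_p F p); first exact: (integral_kcomp l j tt F0 mF).
rewrite lE; apply: eq_integral => w _.
by rewrite jE ge0_integral_pushforward//; exact: measurable_pair1.
Qed.

End conditional_law.

Section conditional_laws.
Context (R : realType) dO (Omega : measurableType dO) (P : probability Omega R).

(** Conditioning on the whole history amounts to conditioning on the part [f] of it on
which the conditional law depends. *)
Lemma cond_law_map d d0 d' (S : measurableType d) (S0 : measurableType d0)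
    (S' : measurableType d') (W : Omega -> S) (Z : Omega -> S') (f : S -> S0)
    (k : S -> {measure set S' -> \bar R}) (k0 : S0 -> {measure set S' -> \bar R}) :
  measurable_fun [set: S] f -> (forall w, k (W w) = k0 (f (W w))) ->
  cond_law P W Z k -> cond_law P (f \o W) Z k0.
Proof.
move=> mf kE WZk A B mA mB.
have := WZk (f @^-1` A) B _ mB; rewrite -[f @^-1` A]setTI => /(_ (mf measurableT _ mA)).
by rewrite setTI => ->; apply: eq_integral => w _; rewrite kE.
Qed.

Context d1 d2 d3 (S : measurableType d1) (S' : measurableType d2)
  (S'' : measurableType d3).
Variables (W : Omega -> S) (Z : Omega -> S') (V : Omega -> S'').
Hypotheses (mW : measurable_fun [set: Omega] W)
  (mZ : measurable_fun [set: Omega] Z) (mV : measurable_fun [set: Omega] V).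

Let mWZ : measurable_fun [set: Omega] (fun w => (W w, Z w)).
Proof. exact: measurable_fun_pair. Qed.

Lemma cond_law_chain (k : R.-pker S ~> S') (l : R.-pker (S * S') ~> S'')
    (m : S -> {measure set S'' -> \bar R}) :
  (forall s B, measurable B -> m s B = \int[k s]_z l (s, z) B) ->
  cond_law P W Z k -> cond_law P (fun w => (W w, Z w)) V l -> cond_law P W V m.
Proof.
move=> mE WZk WZVl A B mA mB.
pose F (p : S * S') := (\1_A p.1)%:E * l p B.
have mF : measurable_fun [set: S * S'] F.
  apply: emeasurable_funM; last exact: measurable_kernel.
  apply/measurable_EFinP; apply: measurableT_comp; [exact: measurable_indic|exact: measurable_fst].
have F0 p : 0 <= F p by rewrite mule_ge0// lee_fin.
have := WZVl (A `*` setT) B (measurableX mA measurableT) mB.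
rewrite (_ : _ @^-1` _ = W @^-1` A); last by apply/seteqP; split=> [w []|w].
move=> ->.
transitivity (\int[P]_w F (W w, Z w)).
  rewrite integral_mkcond; apply: eq_integral => w _; rewrite patchE /F indicE /=.
  by rewrite mem_preimage; case: ifP => _; rewrite ?mul1e ?mul0e.
rewrite (cond_law_integral mW mZ WZk)// [RHS]integral_mkcond.
apply: eq_integral => w _; rewrite patchE mem_preimage /F /= indicE.
case: ifP => _; last by rewrite integral0_eq// => z _; rewrite mul0e.
by rewrite mE//; apply: eq_integral => z _; rewrite mul1e.
Qed.

(** A randomised control [V] drawn on the basis of [W] alone carries no information on
[Z] beyond [W]: this is what allows arbitrary policies. *)
Lemma cond_law_exchange (k : R.-pker S ~> S') (gamma : R.-pker S ~> S'') :
  cond_law P W Z k ->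
  cond_law P (fun w => (W w, Z w)) V (fun p => gamma p.1) ->
  cond_law P (fun w => (W w, V w)) Z (fun p => k p.1).
Proof.
move=> WZk WZVg A B mA mB.
have mg D : measurable D -> measurable_fun [set: S * S'] (fun p => gamma p.1 D).
  by move=> mD; exact: measurableT_comp (measurable_kernel gamma D mD) measurable_fst.
have [g gE] := ex_pker mg (fun p => @prob_kernel _ _ _ _ _ gamma p.1).
have WZVg' : cond_law P (fun w => (W w, Z w)) V g.
  move=> D E mD mE; rewrite WZVg//; apply: eq_integral => w _; by rewrite gE.
have WVg : cond_law P W V gamma.
  exact: (cond_law_map (f := fst) (W := fun w => (W w, Z w)) measurable_fst _ WZVg).
have mA1 : measurable_fun [set: (S * S') * S''] (fun q => (\1_A (q.1.1, q.2))%:E : \bar R).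
  apply/measurable_EFinP; apply: measurableT_comp; first exact: measurable_indic.
  apply: measurable_fun_pair => //.
  exact: measurableT_comp measurable_fst measurable_fst.
pose F (q : (S * S') * S'') : \bar R := (\1_B q.1.2)%:E * (\1_A (q.1.1, q.2))%:E.
have mF : measurable_fun [set: (S * S') * S''] F.
  apply: emeasurable_funM => //; apply/measurable_EFinP.
  apply: measurableT_comp; first exact: measurable_indic.
  exact: measurableT_comp measurable_snd measurable_fst.
have F0 q : 0 <= F q by rewrite mule_ge0// lee_fin.
have mAg : measurable_fun [set: S] (fun s => gamma s (xsection A s)).
  by apply: measurable_fun_xsection_finite_kernel; rewrite inE.
pose H (p : S * S') : \bar R := (\1_B p.2)%:E * gamma p.1 (xsection A p.1).
have mH : measurable_fun [set: S * S'] H.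
  apply: emeasurable_funM; last exact: measurableT_comp mAg measurable_fst.
  apply/measurable_EFinP; apply: measurableT_comp; [exact: measurable_indic|exact: measurable_snd].
have H0 p : 0 <= H p by rewrite mule_ge0// lee_fin.
have gA s : \int[gamma s]_v (\1_A (s, v))%:E = gamma s (xsection A s).
  rewrite -[RHS]mul1e -integral_cst; last exact: measurable_xsection.
  rewrite [RHS]integral_mkcond; apply: eq_integral => v _.
  by rewrite patchE indicE mem_xsection; case: ifP.
transitivity (\int[P]_w F ((W w, Z w), V w)).
  rewrite -[LHS]mul1e -integral_cst; last first.
    by apply: measurableI; apply: measurable_preimage => //; exact: measurable_fun_pair.
  rewrite integral_mkcond; apply: eq_integral => w _.
  rewrite patchE in_setI /F /= !indicE !mem_preimage.
  by case: (_ \in A); case: (_ \in B); rewrite /= ?mule1 ?mul0e ?mule0.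
rewrite (cond_law_integral mWZ mV WZVg')//.
transitivity (\int[P]_w H (W w, Z w)).
  apply: eq_integral => w _; rewrite gE /F /H /= ge0_integralZl//.
  - by rewrite gA.
  - by have := measurable_fun_pair2 (W w, Z w) mA1.
rewrite (cond_law_integral mW mZ WZk)//.
pose L (p : S * S'') : \bar R := (\1_A p)%:E * k p.1 B.
have mL : measurable_fun [set: S * S''] L.
  apply: emeasurable_funM; first by apply/measurable_EFinP; exact: measurable_indic.
  exact: measurableT_comp (measurable_kernel k B mB) measurable_fst.
have L0 p : 0 <= L p by rewrite mule_ge0// lee_fin.
transitivity (\int[P]_w L (W w, V w)); last first.
  rewrite [RHS]integral_mkcond; apply: eq_integral => w _.
  by rewrite patchE /L indicE mem_preimage; case: ifP; rewrite ?mul1e ?mul0e.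
rewrite (cond_law_integral mW mV WVg)//; apply: eq_integral => w _.
rewrite /H /L /=; under [RHS]eq_integral do rewrite muleC.
rewrite [RHS]ge0_integralZl//; last first.
  apply/measurable_EFinP.
  by apply: measurableT_comp; [exact: measurable_indic|exact: measurable_pair1].
under eq_integral do rewrite muleC.
rewrite ge0_integralZl//; last by apply/measurable_EFinP; exact: measurable_indic.
by rewrite gA integral_indic// setIT muleC.
Qed.

End conditional_laws.

Section uniqueness.
Context (R : realType) dO (Omega : measurableType dO) (P : probability Omega R).

(** For each event the two laws agree almost surely; countably many events determine
them, so the exceptional sets can be merged. *)
Lemma cond_law_unique d d' (S : measurableType d) (T : measurableType d')
    (W : Omega -> S) (Z : Omega -> T) (p q : R.-spker S ~> T) (C : nat -> set T) :
  generating_algebra C -> measurable_fun [set: Omega] W ->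
  cond_law P W Z p -> cond_law P W Z q ->
  {ae P, forall w, forall A, measurable A -> p (W w) A = q (W w) A}.
Proof.
move=> genC mW WZp WZq; have [mC _ _ _] := genC.
have [PW PWE] := ex_pushforward P mW.
have ae1 B : measurable B -> {ae P, forall w, p (W w) B = q (W w) B}.
  move=> mB.
  have k_le1 (k : R.-spker S ~> T) s : k s B <= 1.
    by apply: le_trans (sprob_kernel_le1 k s); apply: le_measure; rewrite ?inE.
  have : ae_eq PW setT (p ^~ B) (q ^~ B).
    apply: integral_ae_eq => //.
    - apply/integrableP; split; first exact: measurable_kernel.
      apply: (@le_lt_trans _ _ (\int[PW]_s cst 1 s)).
        apply: ge0_le_integral => //; first exact: measurableT_comp (measurable_kernel p B mB).
        by move=> s _; rewrite gee0_abs.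
      by rewrite integral_cst// mul1e PWE /pushforward preimage_setT /= probability_setT ltry.
    - exact: measurable_kernel.
    - move=> E _ mE; rewrite PWE !ge0_integral_pushforward//.
      + by transitivity (P (W @^-1` E `&` Z @^-1` B)); [rewrite WZp|rewrite WZq].
      + exact: measurable_funTS (measurable_kernel q B mB).
      + exact: measurable_funTS (measurable_kernel p B mB).
  move=> [N [mN N0 subN]]; exists (W @^-1` N); split.
  - exact: measurable_preimage.
  - by move: N0; rewrite PWE.
  - by move=> w /= nw; apply: subN => /= h; apply: nw; exact: h.
have : {ae P, forall w, forall n, p (W w) (C n) = q (W w) (C n)}.
  by apply/ae_foralln => n; exact: ae1.
have := ae1 _ measurableT; apply: filterS2 => w pqT pqC A mA.
have finP (k : R.-spker S ~> T) : exists m : {finite_measure set T -> \bar R},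
    (k (W w) : set T -> \bar R) = m.
  by apply: finite_measureP; apply: le_lt_trans (sprob_kernel_le1 k _) (ltry _).
have [m1 m1E] := finP p; have [m2 m2E] := finP q.
rewrite m1E m2E; apply: (finite_measure_eq_algebra genC) => //.
- by move=> n; rewrite -m1E -m2E.
- by rewrite -m1E -m2E.
Qed.

End uniqueness.

(** * Posterior laws *)

Section bayes.
Context (R : realType) dX dY (X : measurableType dX) (Y : measurableType dY).
Variables (Q : R.-pker X ~> Y) (lambda : probability Y R) (g : X * Y -> R).
Hypothesis likg : is_likelihood Q lambda g.

Let mg : measurable_fun [set: X * Y] g. Proof. by case: likg. Qed.
Let g0 xy : (0 <= g xy)%R. Proof. by case: likg. Qed.

Local Notation lik m B y := (\int[m]_(x in B) (g (x, y))%:E).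

(** The likelihood agrees [lambda]-almost everywhere with the Radon-Nikodym derivative,
for which the change of variables is known. *)
Lemma integral_density x (f : Y -> \bar R) : (forall y, 0 <= f y) ->
  measurable_fun [set: Y] f ->
  \int[Q x]_y f y = \int[lambda]_y (f y * (g (x, y))%:E).
Proof.
move=> f0 mf; have [_ _ Qg] := likg.
have [q qE] := probabilityP (@prob_kernel _ _ _ _ _ Q x).
have mgx : measurable_fun [set: Y] (fun y => (g (x, y))%:E).
  by apply/measurable_EFinP; exact: measurableT_comp mg (measurable_pair1 x).
have qlam : q `<< lambda.
  apply/null_content_dominatesP => A mA A0; rewrite -qE Qg//.
  have := @integral_abs_eq0 _ _ _ lambda A (fun y => (g (x, y))%:E) mA (measurable_funTS mgx) A0.
  by under eq_integral do rewrite gee0_abs ?lee_fin//.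
pose h := Radon_Nikodym_SigmaFinite.f q lambda.
have hint := Radon_Nikodym_SigmaFinite.f_integrable qlam.
have mh := measurable_int _ hint.
have gh : ae_eq lambda setT h (fun y => (g (x, y))%:E).
  apply: integral_ae_eq => // A _ mA.
  rewrite -Radon_Nikodym_SigmaFinite.f_integral//.
  by transitivity (Q x A); [rewrite qE|rewrite Qg].
rewrite qE -(Radon_Nikodym_SigmaFinite.change_of_variables qlam)//.
apply: ae_eq_integral => //; [exact: emeasurable_funM|exact: emeasurable_funM|].
exact: (ae_eqe_mul2l f gh).
Qed.

Context dO (Omega : measurableType dO) (P : probability Omega R).
Context dS (S : measurableType dS).
Variables (W : Omega -> S) (Z : Omega -> X) (V : Omega -> Y).
Hypotheses (mW : measurable_fun [set: Omega] W)
  (mZ : measurable_fun [set: Omega] Z) (mV : measurable_fun [set: Omega] V).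
Variable k : R.-pker S ~> X.
Hypothesis WZk : cond_law P W Z k.
Hypothesis WZVQ : cond_law P (fun w => (W w, Z w)) V (fun p => Q p.2).

Let mWZ : measurable_fun [set: Omega] (fun w => (W w, Z w)).
Proof. exact: measurable_fun_pair. Qed.

Let mWV : measurable_fun [set: Omega] (fun w => (W w, V w)).
Proof. exact: measurable_fun_pair. Qed.

(** The joint law of the state and the observation has the likelihood as its density
with respect to the product of the law of the state and the reference measure. *)
Lemma integral_state_observation (F : S * Y -> \bar R) (B : set X) :
  (forall p, 0 <= F p) -> measurable_fun [set: S * Y] F -> measurable B ->
  \int[P]_w ((\1_B (Z w))%:E * F (W w, V w)) =
  \int[P]_w \int[lambda]_y (F (W w, y) * lik (k (W w)) B y).
Proof.
move=> F0 mF mB.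
have mQ D : measurable D -> measurable_fun [set: S * X] (fun p => Q p.2 D).
  by move=> mD; exact: measurableT_comp (measurable_kernel Q D mD) measurable_snd.
have [q qE] := ex_pker mQ (fun p => @prob_kernel _ _ _ _ _ Q p.2).
have WZVq : cond_law P (fun w => (W w, Z w)) V q.
  move=> D E mD mE; rewrite WZVQ//; apply: eq_integral => w _; by rewrite qE.
pose F1 (p : (S * X) * Y) : \bar R := (\1_B p.1.2)%:E * F (p.1.1, p.2).
have mB1 : measurable_fun [set: (S * X) * Y] (fun p => (\1_B p.1.2)%:E : \bar R).
  apply/measurable_EFinP; apply: measurableT_comp; first exact: measurable_indic.
  exact: measurableT_comp measurable_snd measurable_fst.
have mFp : measurable_fun [set: (S * X) * Y] (fun p => F (p.1.1, p.2)).
  apply: (measurableT_comp mF); apply: measurable_fun_pair => //.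
  exact: measurableT_comp measurable_fst measurable_fst.
have mF1 : measurable_fun [set: (S * X) * Y] F1 by exact: emeasurable_funM.
have F10 p : 0 <= F1 p by rewrite mule_ge0// lee_fin.
pose F2 (p : (S * X) * Y) : \bar R := F1 p * (g (p.1.2, p.2))%:E.
have mF2 : measurable_fun [set: (S * X) * Y] F2.
  apply: emeasurable_funM => //; apply/measurable_EFinP.
  apply: (measurableT_comp mg); apply: measurable_fun_pair => //.
  exact: measurableT_comp measurable_snd measurable_fst.
have F20 p : 0 <= F2 p by rewrite mule_ge0// lee_fin.
pose H (p : S * X) := \int[lambda]_y F2 (p, y).
have mH : measurable_fun [set: S * X] H by exact: measurable_fun_fubini_tonelli_F.
have H0 p : 0 <= H p by exact: integral_ge0.
transitivity (\int[P]_w F1 ((W w, Z w), V w)) => //.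
rewrite (cond_law_integral mWZ mV WZVq)//.
transitivity (\int[P]_w H (W w, Z w)).
  apply: eq_integral => w _; rewrite qE /= integral_density//.
  exact: measurable_fun_pair2 mF1.
rewrite (cond_law_integral mW mZ WZk)//; apply: eq_integral => w _.
have mF3 : measurable_fun [set: X * Y] (fun p => F2 ((W w, p.1), p.2)).
  apply: (measurableT_comp mF2); apply: measurable_fun_pair => //.
  exact: measurable_fun_pair.
have [m mE] := probabilityP (@prob_kernel _ _ _ _ _ k (W w)).
rewrite mE /H (sfinite_Fubini m lambda (fun p => F2 ((W w, p.1), p.2)))//.
apply: eq_integral => y _.
have mgy : measurable_fun [set: X] (fun x => (g (x, y))%:E).
  exact: measurable_lik_snd.
rewrite [in RHS]integral_mkcond -ge0_integralZl//; last 2 first.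
- by apply/(measurable_restrictT _ mB); exact: measurable_funTS.
- by move=> x _; apply: erestrict_ge0 => // x' _; rewrite lee_fin.
apply: eq_integral => x _; rewrite /F2 /F1 /= patchE indicE muleAC.
by case: ifP => _; rewrite ?mul1e ?mul0e ?mule0 // muleC.
Qed.

Lemma integral_observation (F : S * Y -> \bar R) :
  (forall p, 0 <= F p) -> measurable_fun [set: S * Y] F ->
  \int[P]_w F (W w, V w) =
  \int[P]_w \int[lambda]_y (F (W w, y) * lik (k (W w)) [set: X] y).
Proof.
move=> F0 mF; rewrite -integral_state_observation//.
by apply: eq_integral => w _; rewrite indicT mul1e.
Qed.

Lemma lik_prior_fin (k' : R.-spker S ~> X) s : (k' s) [set: X] = 1 ->
  {ae lambda, forall y, lik (k' s) [set: X] y < +oo}.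
Proof.
by move=> /probabilityP[m ->]; exact: lik_lty_ae likg m.
Qed.

(** The observation has density equal to the evidence, so an event has probability one
as soon as it holds at [lambda]-almost every observation of positive evidence. *)
Lemma ae_observation (E : set (S * Y)) : measurable E ->
  {ae P, forall w, {ae lambda, forall y, E (W w, y) \/ lik (k (W w)) [set: X] y = 0}} ->
  {ae P, forall w, E (W w, V w)}.
Proof.
move=> mE aeE.
have mEc : measurable (~` E) by exact: measurableC.
have mI : measurable_fun [set: S * Y] (fun p => (\1_(~` E) p)%:E : \bar R).
  by apply/measurable_EFinP; exact: measurable_indic.
exists ((fun w => (W w, V w)) @^-1` (~` E)); split => //.
  exact: measurable_preimage.
rewrite -[LHS]mul1e -integral_cst; last exact: measurable_preimage.
rewrite integral_mkcond.
transitivity (\int[P]_w (\1_(~` E) (W w, V w))%:E).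
  by apply: eq_integral => w _; rewrite patchE indicE mem_preimage; case: ifP.
rewrite (integral_observation _ mI) => [|p]; last by rewrite lee_fin.
have mlikW : measurable_fun [set: S * Y] (fun p => lik (k p.1) [set: X] p.2).
  exact: (measurable_lik mg g0 k measurableT).
have mH : measurable_fun [set: S]
    (fun s => \int[lambda]_y ((\1_(~` E) (s, y))%:E * lik (k s) [set: X] y)).
  apply: (measurable_fun_fubini_tonelli_F
    (fun p : S * Y => (\1_(~` E) p)%:E * lik (k p.1) [set: X] p.2)).
    exact: emeasurable_funM.
  by move=> p; apply: mule_ge0; [rewrite lee_fin|exact: lik_ge0].
rewrite (ae_eq_integral (cst 0)) ?integral0//; first exact: measurableT_comp mH mW.
apply: filterS aeE => w aey _ /=.
rewrite (ae_eq_integral (cst 0)) ?integral0//.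
  by apply: emeasurable_funM; [exact: measurable_fun_pair2 mI|exact: measurable_fun_pair2 mlikW].
apply: filterS aey => y [Ey|->] _; last by rewrite mule0.
by rewrite indicE (_ : _ \in _ = false) ?mul0e//; apply/negbTE; rewrite notin_setE; apply.
Qed.

(** Against the density of the observation, the evidence in the denominator cancels.
This fails only at observations of infinite evidence, which are [lambda]-null. *)
Lemma cond_law_bayes (b : R.-spker (S * Y) ~> X) :
  (forall s y, (b (s, y) : set X -> \bar R) = bayes_update g (k s) y) ->
  cond_law P (fun w => (W w, V w)) Z b.
Proof.
move=> bE A B mA mB.
have mI : measurable_fun [set: S * Y] (fun p => (\1_A p)%:E : \bar R).
  by apply/measurable_EFinP; exact: measurable_indic.
transitivity (\int[P]_w ((\1_B (Z w))%:E * (\1_A (W w, V w))%:E)).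
  rewrite -[LHS]mul1e -integral_cst; last first.
    by apply: measurableI; exact: measurable_preimage.
  rewrite integral_mkcond; apply: eq_integral => w _.
  rewrite patchE in_setI !indicE !mem_preimage.
  by case: (_ \in A); case: (_ \in B); rewrite /= ?mule1 ?mul0e ?mule0.
rewrite (integral_state_observation _ mI)//.
pose F (p : S * Y) := (\1_A p)%:E * b p B.
have mF : measurable_fun [set: S * Y] F.
  by apply: emeasurable_funM => //; exact: measurable_kernel.
have F0 p : 0 <= F p by rewrite mule_ge0// lee_fin.
transitivity (\int[P]_w F (W w, V w)); last first.
  rewrite [RHS]integral_mkcond; apply: eq_integral => w _.
  by rewrite patchE /F indicE mem_preimage; case: ifP; rewrite ?mul1e ?mul0e.
rewrite [RHS](integral_observation F0 mF); apply: eq_integral => w _.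
have mlikW D : measurable D ->
    measurable_fun [set: S * Y] (fun p => lik (k p.1) D p.2).
  by move=> mD; exact: (measurable_lik mg g0 k mD).
apply: ae_eq_integral => //.
- apply: emeasurable_funM; first exact: measurable_fun_pair2 mI.
  exact: measurable_fun_pair2 (mlikW _ mB).
- apply: emeasurable_funM; first exact: measurable_fun_pair2 mF.
  exact: measurable_fun_pair2 (mlikW _ measurableT).
have := lik_prior_fin (@prob_kernel _ _ _ _ _ k (W w)).
apply: filterS => y loo _; rewrite /F -muleA; congr (_ * _).
rewrite bE (bayes_updateE g0).
have l0 : 0 <= lik (k (W w)) [set: X] y by exact: lik_ge0.
have lB : lik (k (W w)) B y <= lik (k (W w)) [set: X] y by exact: lik_subset_le.
have lB0 : 0 <= lik (k (W w)) B y by exact: lik_ge0.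
move: l0 lB loo; case: (lik (k (W w)) [set: X] y) => [r| |] // r0 lB _.
have [r1|r1] := eqVneq r 0%R.
  rewrite r1 mule0; apply/eqP; rewrite eq_le lB0 andbT.
  by move: lB; rewrite r1.
rewrite /= powR_inv1 -?lee_fin// muleAC -EFinM mulVf// mul1e.
by [].
Qed.

End bayes.

(** * One step of the filter *)

Section update_step.
Context (R : realType) dX dY (X : measurableType dX) (Y : measurableType dY).
Variables (Q : R.-pker X ~> Y) (lambda : probability Y R) (g : X * Y -> R).
Hypothesis likg : is_likelihood Q lambda g.
Variable C : nat -> set X.
Hypothesis genC : generating_algebra C.

Let mg : measurable_fun [set: X * Y] g. Proof. by case: likg. Qed.
Let g0 xy : (0 <= g xy)%R. Proof. by case: likg. Qed.

Local Notation lik m B y := (\int[m]_(x in B) (g (x, y))%:E).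

Context dO (Omega : measurableType dO) (P : probability Omega R).
Context dS (S : measurableType dS).
Variables (W : Omega -> S) (Z : Omega -> X) (V : Omega -> Y).
Hypotheses (mW : measurable_fun [set: Omega] W)
  (mZ : measurable_fun [set: Omega] Z) (mV : measurable_fun [set: Omega] V).
Variables (k1 : R.-pker S ~> X) (k2 : R.-spker S ~> X) (p : R.-pker (S * Y) ~> X).
Hypothesis WZk1 : cond_law P W Z k1.
Hypothesis WZVQ : cond_law P (fun w => (W w, Z w)) V (fun p => Q p.2).
Hypothesis WVZp : cond_law P (fun w => (W w, V w)) Z p.
Hypothesis k12 : {ae P, forall w, k1 (W w) `<< k2 (W w) /\ k2 (W w) [set: X] = 1}.

Let mWV : measurable_fun [set: Omega] (fun w => (W w, V w)).
Proof. exact: measurable_fun_pair. Qed.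

(** Conditional laws being unique, the true posterior [p] is given by Bayes' formula. *)
Lemma ae_posterior : exists2 b1 : R.-spker (S * Y) ~> X,
  forall s y, (b1 (s, y) : set X -> \bar R) = bayes_update g (k1 s) y &
  {ae P, forall w, forall A, measurable A -> p (W w, V w) A = b1 (W w, V w) A}.
Proof.
have [b1 b1E] := ex_bayes_kernel mg g0 k1; exists b1 => //.
apply: (@cond_law_unique _ _ _ P _ _ _ _ (fun w => (W w, V w)) Z p b1 C genC mWV WVZp).
exact: (cond_law_bayes likg mW mZ mV WZk1 WZVQ b1E).
Qed.

(** Where the true evidence is positive so is the wrong one, by domination; hence the
wrong posterior is almost surely a genuine normalised measure. *)
Lemma update_step_dominates : {ae P, forall w,
  p (W w, V w) `<< bayes_update g (k2 (W w)) (V w) /\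
  bayes_update g (k2 (W w)) (V w) [set: X] = 1}.
Proof.
have [b1 b1E pb1] := ae_posterior.
pose E := [set q : S * Y | 0 < lik (k2 q.1) [set: X] q.2 < +oo].
have mE : measurable E.
  have ml := measurable_lik mg g0 k2 measurableT.
  rewrite (_ : E = [set q | 0 < lik (k2 q.1) [set: X] q.2] `&`
                   [set q | lik (k2 q.1) [set: X] q.2 < +oo]).
    rewrite -[X in measurable (X `&` _)]setTI -[X in measurable (_ `&` X)]setTI.
    by apply: measurableI; [exact: emeasurable_fun_o_infty|exact: emeasurable_fun_infty_o].
  by apply/seteqP; split=> q; rewrite /E /= => /andP.
have aeE : {ae P, forall w, E (W w, V w)}.
  apply: (ae_observation likg mW mZ mV WZk1 WZVQ mE).
  apply: filterS k12 => w [k12w k2w].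
  apply: filterS (lik_prior_fin likg k2w) => y l2oo.
  have [l2|l2] := eqVneq (lik (k2 (W w)) [set: X] y) 0.
    by right; exact: (lik_dominates likg measurableT k12w).
  left; rewrite /E /= l2oo andbT lt0e l2 /=; exact: lik_ge0.
apply: filterS3 k12 aeE pb1 => w [k12w k2w] Ew pw; split; last exact: bayes_update_setT.
have := bayes_update_dominates likg k12w Ew.
move=> b12 A A0 B mB BA; rewrite pw// b1E; exact: (b12 A A0 B mB BA).
Qed.

(** Disintegrated along the observation, the left-hand side carries the weight of
[bayes_update_tv]. *)
Lemma update_step_tv :
  \int[P]_w tv_dist (p (W w, V w)) (bayes_update g (k2 (W w)) (V w)) <=
  (2%:E - dobrushin Q) * \int[P]_w tv_dist (k1 (W w)) (k2 (W w)).
Proof.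
have [b1 b1E pb1] := ae_posterior.
have [b2 b2E] := ex_bayes_kernel mg g0 k2.
have mtv2 dT (T : measurableType dT) (l1 l2 : R.-spker T ~> X) :
  measurable_fun [set: T] (fun t => tv_dist (l1 t) (l2 t)) :=
  measurable_tv_dist genC l1 l2.
have mk := mtv2 _ _ k1 k2; have mb := mtv2 _ _ b1 b2; have mp := mtv2 _ _ p b2.
pose F (q : S * Y) : \bar R := tv_dist (b1 q) (b2 q).
have F0 q : 0 <= F q by exact: tv_dist_ge0.
under eq_integral do rewrite -b2E.
rewrite (@ge0_ae_eq_integral _ _ _ P setT _ (fun w => F (W w, V w)))//; first last.
- apply: filterS pb1 => w pw _.
  by apply: tv_dist_eq.
- by move=> w _; exact: tv_dist_ge0.
- exact: measurableT_comp mb mWV.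
- exact: measurableT_comp mp mWV.
rewrite (integral_observation likg mW mZ mV WZk1 WZVQ F0 mb).
have d2 : 0 <= 2%:E - dobrushin Q.
  have [w0 _] := probability_inhabited P.
  rewrite sube_ge0 ?orbT//; apply: (le_trans (dobrushin_le1 Q (Z w0))).
  by rewrite lee_fin; lra.
have mkW : measurable_fun [set: Omega] (fun w => tv_dist (k1 (W w)) (k2 (W w))).
  exact: measurableT_comp mk mW.
rewrite -ge0_integralZl//; last by move=> w _; exact: tv_dist_ge0.
have mlik1 : measurable_fun [set: S * Y] (fun q => lik (k1 q.1) [set: X] q.2).
  exact: (measurable_lik mg g0 k1 measurableT).
have mH : measurable_fun [set: S]
    (fun s => \int[lambda]_y (F (s, y) * lik (k1 s) [set: X] y)).
  apply: (measurable_fun_fubini_tonelli_F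
    (fun q : S * Y => F q * lik (k1 q.1) [set: X] q.2)).
    exact: emeasurable_funM.
  by move=> q; apply: mule_ge0 => //; exact: lik_ge0.
apply: ae_ge0_le_integral => //.
- by move=> w _; apply: integral_ge0 => y _; apply: mule_ge0 => //; exact: lik_ge0.
- exact: measurableT_comp mH mW.
- by move=> w _; rewrite mule_ge0// tv_dist_ge0.
- exact: measurable_funeM.
apply: filterS k12 => w [k12w /probabilityP[s2 s2E]] _.
have [s1 s1E] := probabilityP (@prob_kernel _ _ _ _ _ k1 (W w)).
under eq_integral do rewrite /F b1E b2E muleC.
rewrite s1E s2E; apply: (bayes_update_tv likg genC).
by rewrite -s1E -s2E.
Qed.

End update_step.

Section predict.
Context (R : realType) dX dU (X : measurableType dX) (U : measurableType dU).
Variable T : R.-pker (X * U) ~> X.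

Lemma ex_predict_kernel dS (S : measurableType dS) (k : R.-spker S ~> X) :
  exists p : R.-spker (S * U) ~> X,
    forall s u, (p (s, u) : set X -> \bar R) = predict T (k s) u.
Proof.
have mk A : measurable A -> measurable_fun [set: S * U] (fun q => k q.1 A).
  by move=> mA; exact: measurableT_comp (measurable_kernel k A mA) measurable_fst.
have [k' k'E] := ex_spker mk (fun q => sprob_kernel_le1 k q.1).
have mT A : measurable A ->
    measurable_fun [set: (S * U) * X] (fun q => T (q.2, q.1.2) A).
  move=> mA; apply: (measurableT_comp (measurable_kernel T A mA)).
  by apply: measurable_fun_pair => //; exact: measurableT_comp measurable_snd measurable_fst.
have [T' T'E] := ex_pker mT (fun q => @prob_kernel _ _ _ _ _ T (q.2, q.1.2)).
have mp A : measurable A -> measurable_fun [set: S * U] (mkcomp k' T' ^~ A).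
  exact: measurable_fun_mkcomp_sfinite.
have kE q A : mkcomp k' T' q A = predict T (k q.1) q.2 A.
  by rewrite /mkcomp /= /kcomp k'E /predict; apply: eq_integral => x _; rewrite T'E.
have [q|p pE] := ex_spker mp.
  rewrite kE /predict; under eq_integral do rewrite prob_kernel.
  by rewrite integral_cst// mul1e sprob_kernel_le1.
by exists p => s u; apply/funext => A; rewrite pE kE.
Qed.

Lemma predict_setT (m : {measure set X -> \bar R}) u :
  predict T m u [set: X] = m [set: X].
Proof.
rewrite /predict; under eq_integral do rewrite prob_kernel.
by rewrite integral_cst// mul1e.
Qed.

Lemma measurable_control u A : measurable A ->
  measurable_fun [set: X] (fun x => T (x, u) A).
Proof. by move=> mA; exact: measurable_fun_pair1 (measurable_kernel T A mA). Qed.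

Lemma ex_control_kernel u : exists K : R.-pker X ~> X,
  (fun x => T (x, u)) = K :> (X -> {measure set X -> \bar R}).
Proof.
have [K KE] := ex_pker (@measurable_control u) (fun x => @prob_kernel _ _ _ _ _ T (x, u)).
by exists K; apply/funext => x; rewrite KE.
Qed.

Lemma predict_dominates (m1 m2 : {measure set X -> \bar R}) u :
  m1 `<< m2 -> predict T m1 u `<< predict T m2 u.
Proof.
move=> m12 A A0 B mB BA; have := A0 B mB BA; rewrite /predict.
have mT := measurable_control u mB.
have abs (m : {measure set X -> \bar R}) :
    \int[m]_x T (x, u) B = \int[m]_x `|T (x, u) B|.
  by apply: eq_integral => x _; rewrite gee0_abs.
rewrite !abs => /(ae_eq_integral_abs _ measurableT mT) h.
by apply/(ae_eq_integral_abs _ measurableT mT); exact: null_dominates_ae_eq h.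
Qed.

(** [integral_kernel_le] at a Hahn set of the predicted measures. *)
Lemma predict_tv (s1 s2 : probability X R) (p1 p2 : {measure set X -> \bar R}) u :
  (p1 : set X -> \bar R) = predict T s1 u ->
  (p2 : set X -> \bar R) = predict T s2 u ->
  tv_dist p1 p2 <= (1 - dobrushin (fun x => T (x, u))) * tv_dist s1 s2.
Proof.
move=> p1E p2E.
have [K KE] := ex_control_kernel u; rewrite KE.
have {}KE x : K x = T (x, u) by rewrite -KE.
have [A hA] := ex_hahn_set s1 s2; have [mA _ _] := hA.
have probE (s : probability X R) (p : {measure set X -> \bar R}) :
    (p : set X -> \bar R) = predict T s u ->
    exists2 q : probability X R, (p : set X -> \bar R) = q &
      forall B, q B = \int[s]_x K x B.
  move=> pE; have [|q qE] := @probabilityP _ _ _ p.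
    by rewrite pE predict_setT; exact: probability_setT.
  by exists q => // B; rewrite -qE pE; apply: eq_integral => x _; rewrite KE.
have [q1 -> q1E] := probE s1 p1 p1E; have [q2 -> q2E] := probE s2 p2 p2E.
have [B hB] := ex_hahn_set q1 q2; have [mB _ _] := hB.
have [x0 _] := probability_inhabited s1.
have dfin := dobrushin_fin_num K x0.
have := integral_kernel_le K hA mB; rewrite -q1E -q2E.
rewrite (tv_dist_probability hA) (tv_dist_probability hB).
have fin (s : probability X R) D : measurable D -> s D \is a fin_num.
  by move=> mD; exact: fin_num_measure.
rewrite -(fineK (fin s1 A mA)) -(fineK (fin s2 A mA)) -(fineK dfin).
rewrite -(fineK (fin q1 B mB)) -(fineK (fin q2 B mB)).
rewrite -!EFinB -!EFinM -!EFinD !lee_fin /=; lra.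
Qed.

End predict.

(** * The information process *)

Section segments.
Context d (A : measurableType d).

Definition drop_last n (t : n.+1.-tuple A) : n.-tuple A :=
  [tuple tnth t (widen_ord (leqnSn n) i) | i < n].

Definition add_last n (t : n.-tuple A) (a : A) : n.+1.-tuple A :=
  [tuple if unlift ord_max i is Some j then tnth t j else a | i < n.+1].

Lemma measurable_drop_last n : measurable_fun [set: n.+1.-tuple A] (@drop_last n).
Proof.
apply/measurable_fun_tnthP => i.
rewrite (_ : _ \o _ = fun t : n.+1.-tuple A => tnth t (widen_ord (leqnSn n) i)).
  exact: measurable_tnth.
by apply/funext => t /=; rewrite tnth_mktuple.
Qed.

Lemma measurable_add_last n :
  measurable_fun [set: (n.-tuple A * A)%type] (fun p => add_last p.1 p.2).
Proof.
apply/measurable_fun_tnthP => i.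
rewrite (_ : _ \o _ = fun p : n.-tuple A * A =>
    if unlift ord_max i is Some j then tnth p.1 j else p.2); last first.
  by apply/funext => p /=; rewrite tnth_mktuple.
case: (unlift ord_max i) => [j|]; last exact: measurable_snd.
exact: measurableT_comp (measurable_tnth j) measurable_fst.
Qed.

Lemma add_drop_last n (t : n.+1.-tuple A) :
  add_last (drop_last t) (tnth t ord_max) = t.
Proof.
apply: eq_from_tnth => i; rewrite tnth_mktuple.
case: unliftP => [j ->|-> //]; rewrite tnth_mktuple; congr (tnth t _).
by apply: val_inj; exact: esym (lift_max j).
Qed.

Lemma drop_last_segment dO (O : measurableType dO) (Z : nat -> O -> A) n w :
  drop_last (segment Z n.+1 w) = segment Z n w.
Proof. by apply: eq_from_tnth => i; rewrite !tnth_mktuple. Qed.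

Lemma last_segment dO (O : measurableType dO) (Z : nat -> O -> A) n w :
  tnth (segment Z n.+1 w) ord_max = Z n w.
Proof. by rewrite tnth_mktuple. Qed.

End segments.

Section dynamics.
Context (R : realType) dX dY dU (X : measurableType dX) (Y : measurableType dY)
  (U : measurableType dU).
Variables (T : R.-pker (X * U) ~> X) (Q : R.-pker X ~> Y)
  (lambda : probability Y R) (g : X * Y -> R).
Hypothesis likg : is_likelihood Q lambda g.
Variable C : nat -> set X.
Hypothesis genC : generating_algebra C.
Variables (gamma : policy R Y U) (mu nu : probability X R).
Hypothesis munu : mu `<< nu.
Context dO (Omega : measurableType dO) (P : probability Omega R).
Variables (X_ : nat -> {RV P >-> X}) (Y_ : nat -> {RV P >-> Y})
  (U_ : nat -> {RV P >-> U}).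
Hypothesis process : controlled_process X_ Y_ U_ mu T Q gamma.
Variable pimu : forall n : nat, R.-pker (n.+1.-tuple Y * n.-tuple U)%type ~> X.
Hypothesis pimuE : is_filter X_ Y_ U_ pimu.

Let mg : measurable_fun [set: X * Y] g. Proof. by case: likg. Qed.
Let g0 xy : (0 <= g xy)%R. Proof. by case: likg. Qed.

Local Notation infoT n := (n.+1.-tuple Y * n.-tuple U)%type.
Local Notation wrong n w :=
  (filter_rec g T nu (fun i => Y_ i w) (fun i => U_ i w) n).

(** [split_info] and [join_info] exchange the information at time [n.+1] with the
information at time [n], the control then applied and the observation that follows:
prediction acts on the first two, the update on the third. *)
Definition split_info n (v : infoT n.+1) : (infoT n * U) * Y :=
  (((drop_last v.1, drop_last v.2), tnth v.2 ord_max), tnth v.1 ord_max).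

Definition join_info n (q : (infoT n * U) * Y) : infoT n.+1 :=
  (add_last q.1.1.1 q.2, add_last q.1.1.2 q.1.2).

Lemma split_infoK n : cancel (@split_info n) (@join_info n).
Proof. by move=> [ys us]; rewrite /join_info /= !add_drop_last. Qed.

Lemma split_info_process n w :
  split_info (info Y_ U_ n.+1 w) = ((info Y_ U_ n w, U_ n w), Y_ n.+1 w).
Proof. by rewrite /split_info /info /= !drop_last_segment !last_segment. Qed.

Lemma measurable_split_info n : measurable_fun [set: infoT n.+1] (@split_info n).
Proof.
have mY := measurableT_comp (@measurable_drop_last _ Y n.+1)
  (@measurable_fst _ _ (n.+2.-tuple Y) (n.+1.-tuple U)).
have mU := measurableT_comp (@measurable_drop_last _ U n)
  (@measurable_snd _ _ (n.+2.-tuple Y) (n.+1.-tuple U)).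
apply: measurable_fun_pair; last exact: measurableT_comp (measurable_tnth _) measurable_fst.
apply: measurable_fun_pair; last exact: measurableT_comp (measurable_tnth _) measurable_snd.
exact: measurable_fun_pair.
Qed.

Lemma measurable_join_info n : measurable_fun [set: (infoT n * U) * Y] (@join_info n).
Proof.
have m11 : measurable_fun [set: (infoT n * U) * Y] (fun q => q.1.1).
  exact: measurableT_comp measurable_fst measurable_fst.
have hY : measurable_fun [set: (infoT n * U) * Y] (fun q => (q.1.1.1, q.2)).
  by apply: measurable_fun_pair => //; exact: measurableT_comp measurable_fst m11.
have hU : measurable_fun [set: (infoT n * U) * Y] (fun q => (q.1.1.2, q.1.2)).
  apply: measurable_fun_pair; first exact: measurableT_comp measurable_snd m11.
  exact: measurableT_comp measurable_snd measurable_fst.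
apply: measurable_fun_pair.
  exact: measurableT_comp (@measurable_add_last _ Y n.+1) hY.
exact: measurableT_comp (@measurable_add_last _ U n) hU.
Qed.

Lemma measurable_segment d (A : measurableType d) (Z : nat -> {RV P >-> A}) n :
  measurable_fun [set: Omega] (segment Z n).
Proof.
apply/measurable_fun_tnthP => i.
rewrite (_ : _ \o _ = Z i); first exact: measurable_funPT.
by apply/funext => w /=; rewrite tnth_mktuple.
Qed.

Lemma measurable_info n : measurable_fun [set: Omega] (info Y_ U_ n).
Proof. by apply: measurable_fun_pair; exact: measurable_segment. Qed.

Let mX n : measurable_fun [set: Omega] (X_ n). Proof. exact: measurable_funPT. Qed.
Let mY n : measurable_fun [set: Omega] (Y_ n). Proof. exact: measurable_funPT. Qed.
Let mU n : measurable_fun [set: Omega] (U_ n). Proof. exact: measurable_funPT. Qed.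

Let mW n : measurable_fun [set: Omega] (fun w => (info Y_ U_ n w, U_ n w)).
Proof. by apply: measurable_fun_pair => //; exact: measurable_info. Qed.

Lemma cond_law_state_control n :
  cond_law P (fun w => (info Y_ U_ n w, U_ n w)) (X_ n) (fun p => pimu n p.1).
Proof.
have [_ _ lawU _] := process.
apply: (cond_law_exchange (@measurable_info n) (@mX n) (@mU n) (gamma := gamma n) (@pimuE n)).
pose f (h : n.+1.-tuple X * n.+1.-tuple Y * n.-tuple U) :=
  ((h.1.2, h.2), tnth h.1.1 ord_max).
rewrite (_ : (fun w => _) = f \o history X_ Y_ U_ n.+1 n.+1 n); last first.
  by apply/funext => w; rewrite /f /history /info /= last_segment.
apply: cond_law_map (lawU n) => //.
apply: measurable_fun_pair.
  apply: measurable_fun_pair => //.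
  exact: measurableT_comp measurable_snd measurable_fst.
apply: measurableT_comp (measurable_tnth _) _.
exact: measurableT_comp measurable_fst measurable_fst.
Qed.

Lemma cond_law_next_state n (k1 : R.-pker (infoT n * U) ~> X) :
  (forall h u, (k1 (h, u) : set X -> \bar R) = predict T (pimu n h) u) ->
  cond_law P (fun w => (info Y_ U_ n w, U_ n w)) (X_ n.+1) k1.
Proof.
move=> k1E; have [_ _ _ lawX] := process.
have mp A : measurable A -> measurable_fun [set: infoT n * U] (fun q => pimu n q.1 A).
  by move=> mA; exact: measurableT_comp (measurable_kernel (pimu n) A mA) measurable_fst.
have [p pE] := ex_pker mp (fun q => @prob_kernel _ _ _ _ _ (pimu n) q.1).
have mT A : measurable A ->
    measurable_fun [set: (infoT n * U) * X] (fun q => T (q.2, q.1.2) A).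
  move=> mA; apply: (measurableT_comp (measurable_kernel T A mA)).
  by apply: measurable_fun_pair => //; exact: measurableT_comp measurable_snd measurable_fst.
have [t tE] := ex_pker mT (fun q => @prob_kernel _ _ _ _ _ T (q.2, q.1.2)).
apply: (cond_law_chain (@mW n) (@mX n) (k := p) (l := t)).
- move=> [h u] B mB; rewrite k1E /predict pE.
  by apply: eq_integral => x _; rewrite tE.
- move=> A B mA mB; rewrite (cond_law_state_control mA mB).
  by apply: eq_integral => w _; rewrite pE.
pose f (h : n.+1.-tuple X * n.+1.-tuple Y * n.+1.-tuple U) :=
  (((h.1.2, drop_last h.2), tnth h.2 ord_max), tnth h.1.1 ord_max).
rewrite (_ : (fun w => _) = f \o history X_ Y_ U_ n.+1 n.+1 n.+1); last first.
  by apply/funext => w; rewrite /f /history /info /= !last_segment drop_last_segment.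
apply: cond_law_map (lawX n); last by move=> w; rewrite tE.
apply: measurable_fun_pair; last first.
  apply: measurableT_comp (measurable_tnth _) _.
  exact: measurableT_comp measurable_fst measurable_fst.
apply: measurable_fun_pair; last exact: measurableT_comp (measurable_tnth _) measurable_snd.
apply: measurable_fun_pair; first exact: measurableT_comp measurable_snd measurable_fst.
exact: measurableT_comp (@measurable_drop_last _ U n) measurable_snd.
Qed.

Lemma cond_law_next_observation n :
  cond_law P (fun w => ((info Y_ U_ n w, U_ n w), X_ n.+1 w)) (Y_ n.+1)
    (fun q => Q q.2).
Proof.
have [_ lawY _ _] := process.
pose f (h : n.+2.-tuple X * n.+1.-tuple Y * n.+1.-tuple U) :=
  (((h.1.2, drop_last h.2), tnth h.2 ord_max), tnth h.1.1 ord_max).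
rewrite (_ : (fun w => _) = f \o history X_ Y_ U_ n.+2 n.+1 n.+1); last first.
  by apply/funext => w; rewrite /f /history /info /= !last_segment drop_last_segment.
apply: cond_law_map (lawY n.+1) => //.
apply: measurable_fun_pair; last first.
  apply: measurableT_comp (measurable_tnth _) _.
  exact: measurableT_comp measurable_fst measurable_fst.
apply: measurable_fun_pair; last exact: measurableT_comp (measurable_tnth _) measurable_snd.
apply: measurable_fun_pair; first exact: measurableT_comp measurable_snd measurable_fst.
exact: measurableT_comp (@measurable_drop_last _ U n) measurable_snd.
Qed.

(** * Induction on time *)

(** [kappa] realises the incorrectly initialised filter as a kernel of the
information, and almost surely it still charges whatever the true filter charges. *)
Definition filter_kernel n (kappa : R.-spker infoT n ~> X) :=
  (forall w, wrong n w = kappa (info Y_ U_ n w) :> (set X -> \bar R)) /\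
  {ae P, forall w, pimu n (info Y_ U_ n w) `<< kappa (info Y_ U_ n w) /\
                   kappa (info Y_ U_ n w) [set: X] = 1}.

(** At time [0] the prior is conditioned on nothing, here a constant of type [unit], so
that the same update step applies with [mu] and [nu] as priors. *)
Lemma ex_filter_kernel0 : exists kappa, @filter_kernel 0 kappa.
Proof.
have [lawX lawY _ _] := process.
pose W (w : Omega) := tt.
have mW0 : measurable_fun [set: Omega] W by exact: measurable_cst.
have [k1 k1E] := @ex_pker _ unit _ X R (fun=> mu) (fun=> fun=> measurable_cst _)
  (fun=> probability_setT mu).
have [k2 k2E] := @ex_spker _ unit _ X R (fun=> nu) (fun=> fun=> measurable_cst _)
  (fun=> sprobability_setT).
have WXk1 : cond_law P W (X_ 0%N) k1.
  move=> A B mA mB; under eq_integral do rewrite k1E.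
  have [Att|nAtt] := pselect (A tt).
    rewrite (_ : W @^-1` A = setT); last by apply/seteqP; split.
    rewrite setTI integral_cst// /= probability_setT mule1.
    exact: lawX.
  rewrite (_ : W @^-1` A = set0); last by apply/seteqP; split=> // w /nAtt.
  by rewrite set0I measure0 integral_set0.
have WXYQ : cond_law P (fun w => (W w, X_ 0%N w)) (Y_ 0%N) (fun p => Q p.2).
  pose f (h : 1.-tuple X * 0.-tuple Y * 0.-tuple U) := (tt, tnth h.1.1 ord_max).
  rewrite (_ : (fun w => _) = f \o history X_ Y_ U_ 1 0 0); last first.
    by apply/funext => w; rewrite /f /history /= last_segment.
  apply: cond_law_map (lawY 0%N) => //.
  apply: measurable_fun_pair => //.
  apply: measurableT_comp (measurable_tnth _) _.
  exact: measurableT_comp measurable_fst measurable_fst.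
pose join0 (q : unit * Y) : infoT 0 := ([tuple q.2], [tuple]).
have mjoin0 : measurable_fun [set: unit * Y] join0.
  apply: measurable_fun_pair; apply/measurable_fun_tnthP => i; last by case: i.
  rewrite (_ : _ \o _ = snd) //; apply/funext => q /=.
  by rewrite (tnth_nth q.2); case: i => -[].
pose split0 (v : infoT 0) : unit * Y := (tt, tnth v.1 ord_max).
have split0K : cancel split0 join0.
  move=> [ys us]; congr pair; apply: eq_from_tnth => i; last by case: i.
  by rewrite (ord1 i) /split0 /=; congr (tnth ys _); apply: val_inj.
have msplit0 : measurable_fun [set: infoT 0] split0.
  by apply: measurable_fun_pair => //; exact: measurableT_comp (measurable_tnth _) measurable_fst.
have infoE w : split0 (info Y_ U_ 0 w) = (W w, Y_ 0%N w).
  by rewrite /split0 /info /= last_segment.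
have mp A : measurable A -> measurable_fun [set: unit * Y] (fun q => pimu 0 (join0 q) A).
  by move=> mA; exact: measurableT_comp (measurable_kernel (pimu 0) A mA) mjoin0.
have [p pE] := ex_pker mp (fun q => @prob_kernel _ _ _ _ _ (pimu 0) (join0 q)).
have WYXp : cond_law P (fun w => (W w, Y_ 0%N w)) (X_ 0%N) p.
  rewrite (_ : (fun w => _) = split0 \o info Y_ U_ 0); last by apply/funext => w /=.
  apply: cond_law_map (@pimuE 0%N) => //.
  by move=> w; rewrite pE split0K.
have k12 : {ae P, forall w, k1 (W w) `<< k2 (W w) /\ k2 (W w) [set: X] = 1}.
  by apply: aeW => w; rewrite k1E k2E; split => //; exact: probability_setT.
have dom := update_step_dominates likg genC mW0 (@mX 0) (@mY 0) WXk1 WXYQ WYXp k12.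
have [b bE] := ex_bayes_kernel mg g0 k2.
have mb A : measurable A -> measurable_fun [set: infoT 0] (fun v => b (split0 v) A).
  by move=> mA; exact: measurableT_comp (measurable_kernel b A mA) msplit0.
have [kappa kappaE] := ex_spker mb (fun v => sprob_kernel_le1 b (split0 v)).
have kE w : (kappa (info Y_ U_ 0 w) : set X -> \bar R) =
    bayes_update g (k2 (W w)) (Y_ 0%N w).
  by rewrite kappaE infoE bE.
exists kappa; split=> [w|]; first by rewrite kE k2E.
apply: filterS dom => w [pk k1w].
by rewrite -(split0K (info Y_ U_ 0 w)) -pE split0K infoE kE.
Qed.

(** The update step is applied to the two predicted measures, which are kernels of the
information and the control at time [n]. *)
Lemma filter_kernel_step n (kappa : R.-spker infoT n ~> X) : filter_kernel kappa ->
  (exists kappa', @filter_kernel n.+1 kappa') /\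
  \int[P]_w tv_dist (pimu n.+1 (info Y_ U_ n.+1 w)) (wrong n.+1 w) <=
  (2%:E - dobrushin Q) * ((1 - ereal_inf
      [set dobrushin (fun x => T (x, u)) | u in [set: U]]) *
    \int[P]_w tv_dist (pimu n (info Y_ U_ n w)) (wrong n w)).
Proof.
move=> [wrongE dom].
pose W w := (info Y_ U_ n w, U_ n w).
have [k1' k1'E] := ex_predict_kernel T (pimu n).
have k1'1 q : k1' q [set: X] = 1.
  by case: q => h u; rewrite k1'E predict_setT; exact: (@prob_kernel _ _ _ _ _ (pimu n) h).
have [k1 k1E'] := ex_pker (measurable_kernel k1') k1'1.
have k1E h u : (k1 (h, u) : set X -> \bar R) = predict T (pimu n h) u.
  by rewrite k1E' k1'E.
have [k2 k2E] := ex_predict_kernel T kappa.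
have WXk1 := cond_law_next_state k1E.
have mp A : measurable A ->
    measurable_fun [set: (infoT n * U) * Y] (fun q => pimu n.+1 (join_info q) A).
  move=> mA; exact: measurableT_comp (measurable_kernel (pimu n.+1) A mA)
    (@measurable_join_info n).
have [p pE] := ex_pker mp (fun q => @prob_kernel _ _ _ _ _ (pimu n.+1) (join_info q)).
have infoE w : join_info (W w, Y_ n.+1 w) = info Y_ U_ n.+1 w.
  by rewrite /W -split_info_process split_infoK.
have WYXp : cond_law P (fun w => (W w, Y_ n.+1 w)) (X_ n.+1) p.
  rewrite (_ : (fun w => _) = @split_info n \o info Y_ U_ n.+1); last first.
    by apply/funext => w /=; rewrite split_info_process.
  apply: cond_law_map (@pimuE n.+1); first exact: measurable_split_info.
  by move=> w; rewrite pE split_infoK.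
have k12 : {ae P, forall w, k1 (W w) `<< k2 (W w) /\ k2 (W w) [set: X] = 1}.
  apply: filterS dom => w [pk kappa1]; rewrite /W k1E k2E predict_setT; split => //.
  exact: predict_dominates.
have up_dom := update_step_dominates likg genC (@mW n) (@mX n.+1) (@mY n.+1)
  WXk1 (@cond_law_next_observation n) WYXp k12.
have up_tv := update_step_tv likg genC (@mW n) (@mX n.+1) (@mY n.+1)
  WXk1 (@cond_law_next_observation n) WYXp k12.
have wrongS w : wrong n.+1 w = bayes_update g (k2 (W w)) (Y_ n.+1 w).
  by rewrite /= wrongE k2E.
split.
  have [b bE] := ex_bayes_kernel mg g0 k2.
  have mb A : measurable A ->
      measurable_fun [set: infoT n.+1] (fun v => b (split_info v) A).
    move=> mA; exact: measurableT_comp (measurable_kernel b A mA) (@measurable_split_info n).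
  have [kappa' kappa'E] := ex_spker mb (fun v => sprob_kernel_le1 b (split_info v)).
  have kE w : (kappa' (info Y_ U_ n.+1 w) : set X -> \bar R) =
      bayes_update g (k2 (W w)) (Y_ n.+1 w).
    by rewrite kappa'E split_info_process bE.
  exists kappa'; split=> [w|]; first by rewrite kE wrongS.
  by apply: filterS up_dom => w; rewrite pE infoE kE.
have d2 : 0 <= 2%:E - dobrushin Q.
  have [w0 _] := probability_inhabited P.
  rewrite sube_ge0 ?orbT//; apply: (le_trans (dobrushin_le1 Q (X_ 0%N w0))).
  by rewrite lee_fin; lra.
apply: (@le_trans _ _ ((2%:E - dobrushin Q) *
    \int[P]_w tv_dist (k1 (W w)) (k2 (W w)))).
  apply: le_trans up_tv; rewrite le_eqVlt; apply/orP; left; apply/eqP.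
  by apply: eq_integral => w _; rewrite pE infoE wrongS.
apply: (lee_wpmul2l d2).
set dinf := ereal_inf _.
have dT_le1 u (x : X) : dobrushin (fun x => T (x, u)) <= 1.
  by have [K ->] := ex_control_kernel T u; exact: dobrushin_le1.
have dinf_le u : dinf <= dobrushin (fun x => T (x, u)).
  by apply: ereal_inf_lbound; exists u.
have mtv : measurable_fun [set: Omega] (fun w =>
    tv_dist (pimu n (info Y_ U_ n w)) (kappa (info Y_ U_ n w))).
  exact: measurableT_comp (measurable_tv_dist genC (pimu n) kappa) (@measurable_info n).
under [in leRHS]eq_integral do rewrite wrongE.
have d1 : 0 <= 1 - dinf.
  have [w0 _] := probability_inhabited P.
  rewrite sube_ge0 ?orbT//; apply: le_trans (dinf_le (U_ 0%N w0)) _.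
  exact: dT_le1 (X_ 0%N w0).
rewrite -ge0_integralZl//; last by move=> w _; exact: tv_dist_ge0.
apply: ae_ge0_le_integral => //.
- by move=> w _; exact: tv_dist_ge0.
- exact: measurableT_comp (measurable_tv_dist genC k1 k2) (@mW n).
- by move=> w _; rewrite mule_ge0// tv_dist_ge0.
- exact: measurable_funeM.
apply: filterS dom => w [_ /probabilityP[s2 s2E]] _.
have [s1 s1E] := probabilityP (@prob_kernel _ _ _ _ _ (pimu n) (info Y_ U_ n w)).
rewrite s1E s2E; apply: (@le_trans _ _
    ((1 - dobrushin (fun x => T (x, U_ n w))) * tv_dist s1 s2)).
  by apply: predict_tv; rewrite /W ?k1E ?k2E ?s1E ?s2E.
apply: lee_wpmul2r; first exact: tv_dist_ge0.
by apply: leeB.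
Qed.

Lemma ex_filter_kernel n : exists kappa, @filter_kernel n kappa.
Proof.
elim: n => [|n [kappa hk]]; first exact: ex_filter_kernel0.
by have [] := filter_kernel_step hk.
Qed.

End dynamics.

(** * Exponential stability *)

Theorem theorem4p1 (R : realType)
    (X Y : ptopologicalType) (polX : polish R X) (polY : polish R Y)
    (dU : measure_display) (U : measurableType dU) (stdU : standard_borel R U)
    (T : R.-pker (borel X * U)%type ~> borel X)
    (Q : R.-pker (borel X) ~> borel Y)
    (lambda : probability (borel Y) R) (domQ : kernel_dominated Q lambda)
    (g : borel X * borel Y -> R) (likg : is_likelihood Q lambda g)
    (alpha : \bar R)
    (alphaE : alpha =
      (1 - ereal_inf [set dobrushin (fun x => T (x, u)) | u in [set: U]])
      * (2%:E - dobrushin Q))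
    (alpha_lt1 : alpha < 1)
    (gamma : policy R (borel Y) U)
    (mu nu : probability (borel X) R) (munu : mu `<< nu)
    (dO : measure_display) (Omega : measurableType dO)
    (Pmu : probability Omega R)
    (X_ : nat -> {RV Pmu >-> borel X}) (Y_ : nat -> {RV Pmu >-> borel Y})
    (U_ : nat -> {RV Pmu >-> U})
    (process : controlled_process X_ Y_ U_ mu T Q gamma)
    (pimu : forall n : nat,
      R.-pker (n.+1.-tuple (borel Y) * n.-tuple U)%type ~> borel X)
    (pimuE : is_filter X_ Y_ U_ pimu) :
  let pinu (n : nat) (w : Omega) :=
    filter_rec g T nu (fun i => Y_ i w) (fun i => U_ i w) n in
  forall n : nat,
    \int[Pmu]_w tv_dist (pimu n.+1 (info Y_ U_ n.+1 w)) (pinu n.+1 w) <=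
    alpha * \int[Pmu]_w tv_dist (pimu n (info Y_ U_ n w)) (pinu n w).
Proof.
move=> pinu n.
have [C genC] := polish_generating_algebra polX.
have [kappa kappaE] := ex_filter_kernel likg genC munu process pimuE n.
have [_] := filter_kernel_step likg genC process pimuE kappaE.
by rewrite alphaE muleA (muleC (2%:E - _)).
Qed.
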